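(* There exists $C>0$ such that for every fixed $d\ge2$ and every (fixed) $k\ge Cd\log d$, a uniformly random $k$-regular graph $G\sim\mathcal G_{n,k}$ on $n$ vertices (with $nk$ even) admits a strong $d$-rigid partition with probability tending to $1$ as $n\to\infty$.
   Context: $\mathcal G_{n,k}$ is the uniform distribution on $k$-regular simple graphs on vertex set $[n]$. For $A,B\subseteq V$, $G[A,B]$ is the graph on $A\cup B$ with the edges of $G$ having one endpoint in $A$ and the other in $B$. A strong $d$-rigid partition of $G$ is a partition $V=V_1\cup\dots\cup V_d$ into nonempty sets such that $G[V_i,V_j]$ is connected for all $1\le i\le j\le d$. Logarithms are natural. *)

(* Defs.v *)
From HB Require Import structures.
From mathcomp Require Import all_boot all_order all_algebra.

Set Implicit Arguments.
Unset Strict Implicit.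
Unset Printing Implicit Defensive.

Import Order.TTheory GRing.Theory Num.Theory.

Local Open Scope ring_scope.

(* A simple graph on the vertex set T is given by its edge set E, a set of
   two-element subsets of T. *)
Definition simple_graph (T : finType) (E : {set {set T}}) : bool :=
  [forall e in E, #|e| == 2%N].

Definition adjacent_vertices (T : finType) (E : {set {set T}}) : rel T :=
  fun x y => [set x; y] \in E.

Definition k_regular (T : finType) (k : nat) (E : {set {set T}}) : bool :=
  [forall x : T, #|[set y | adjacent_vertices E x y]| == k].

Definition regular_graphs (n k : nat) : {set {set {set 'I_n}}} :=
  [set E : {set {set 'I_n}} | simple_graph E && k_regular k E].

(* Adjacency in G[A,B]; for A = B this is the induced subgraph on A. *)
Definition adjacent_between (T : finType) (E : {set {set T}})
    (A B : {set T}) : rel T :=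
  fun x y => adjacent_vertices E x y &&
    ((x \in A) && (y \in B) || (x \in B) && (y \in A)).

(* Steps of [adjacent_between] never leave A :|: B, so [connect] on the ambient
   type T is reachability inside the graph G[A,B]. *)
Definition connected_between (T : finType) (E : {set {set T}})
    (A B : {set T}) : bool :=
  [forall x in A :|: B, forall y in A :|: B,
     connect (adjacent_between E A B) x y].

(* [partition] already requires the parts to be nonempty.  G[A,B] = G[B,A], so
   all pairs (A, B), with A = B allowed, are the pairs i <= j of an indexing
   V_1, ..., V_d of P. *)
Definition strong_rigid_partition (T : finType) (d : nat) (E : {set {set T}})
    (P : {set {set T}}) : bool :=
  [&& partition P [set: T], #|P| == d
    & [forall A in P, forall B in P, connected_between E A B]].

Definition has_strong_rigid_partition (T : finType) (d : nat)
    (E : {set {set T}}) : bool :=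
  [exists P : {set {set T}}, strong_rigid_partition d E P].

(* Probability of Q under the uniform distribution on S (0 if S is empty). *)
Definition prob_uniform_on (R : numFieldType) (T : finType) (S : {set T})
    (Q : pred T) : R :=
  #|[set x in S | Q x]|%:R / #|S|%:R.

(* Main.v *)
(* Switching two edges ab, ce of a k-regular graph to ac, be is reversible, so
   counting forward and backward switchings compares classes of k-regular
   graphs.  With t about k / (16 d) and sg about n / (1024 d), two facts follow
   with high probability.  First, a fixed edge set F lies in the graph with
   probability at most (2 k / n) ^ #|F|, so by a union bound every vertex set S
   with #|S| <= 2 sg spans fewer than t #|S| edges.  Second, the number of graphs
   with j edges between two disjoint sets of size sg grows by a factor at least 2
   every second step as long as j is small, so the graphs with no such edge are
   exponentially rare; the rate beats the number of pairs of sets once t is a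
   large multiple of ln d.
   On the other hand, as k >= C d ln d, the local lemma colours the vertices of
   any k-regular graph with d colours so that every vertex has at least 2 t
   neighbours of each colour.  Let V_1, ..., V_d be the colour classes.  Every
   connected component of G[V_i, V_j] then spans t edges per vertex, hence has
   more than 2 sg vertices.  If there were two components, one of them would meet
   V_i and the rest would meet V_j (or vice versa) in at least sg vertices, with
   no edge in between. *)

Require Import Defs.
From HB Require Import structures.
From mathcomp Require Import all_boot all_order all_algebra.
From mathcomp Require Import zify ring lra.

Set Implicit Arguments.
Unset Strict Implicit.
Unset Printing Implicit Defensive.

(** * Numerical estimates *)

Lemma bin_leq_exp2 n m : 'C(n, m) <= 2 ^ n.
Proof.
elim: n m => [|n IH] [|m] //; first by rewrite bin0 expn_gt0.
by rewrite binS expnS mul2n -addnn leq_add.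
Qed.

(** A division-free Stirling bound: $s^s s! \le (2s)! = \binom{2s}{s} s!^2$, and $\binom{2s}{s} \le
    4^s$. *)
Lemma expn_self_leq_fact s : s ^ s <= 4 ^ s * s`!.
Proof.
have h j : s ^ j * s`! <= (s + j)`!.
  elim: j => [|j IH]; first by rewrite mul1n addn0.
  by rewrite expnS -mulnA addnS factS leq_mul // ltnW // ltnS leq_addr.
have := bin_fact (leq_addr s s); rewrite addnK => e.
have := h s; rewrite -{}e mulnA leq_pmul2r ?fact_gt0 // => h1.
apply: leq_trans h1 _; rewrite leq_mul2r; apply/orP; right.
by rewrite -[4]/(2 ^ 2) -expnM mul2n -addnn; apply: bin_leq_exp2.
Qed.

Lemma leq_expl m n e : m <= n -> m ^ e <= n ^ e.
Proof. by case: e => // e mn; rewrite leq_exp2r. Qed.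

Lemma bin_mul_self n s : 'C(n, s) * s ^ s <= (4 * n) ^ s.
Proof.
apply: leq_trans (leq_mul (leqnn _) (expn_self_leq_fact s)) _.
rewrite mulnCA bin_ffact expnMn leq_mul2l; apply/orP; right.
by elim: s => [|s IH] //; rewrite ffactnSr expnSr leq_mul // leq_subr.
Qed.

(** By $\binom ns \le (4n/s)^s$ and $\binom{\binom s2}{ts} \le (4s/t)^{ts}$, the share $b/G$ is at
    most $((4n/s)(ads/n)^t)^s$. Two of the factors $ads/n$ turn $4n/s$ into $4(ad)^2 s/n$, each
    remaining one is at most $1/2$, and $(4ad)^2 \le 2^t$ absorbs the constants. The share is thus
    at most $(s/n)^s$. *)
Lemma dense_set_term a b d k n s t G : 0 < s -> 0 < t ->
  8 * k <= a * d * t -> 2 * (a * d * s) <= n -> (4 * a * d) ^ 2 <= 2 ^ t ->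
  b * n ^ (t * s) <= 'C(n, s) * 'C('C(s, 2), t * s) * (2 * k) ^ (t * s) * G ->
  b * n ^ s <= s ^ s * G.
Proof.
move=> s0 t0 hk hn ht hb.
have [a0|a0] := posnP (a * d).
  have k0 : k = 0 by move: hk; rewrite a0; lia.
  move: hb; rewrite k0 muln0 exp0n ?muln_gt0 ?t0 // muln0 mul0n leqn0 muln_eq0 => /orP[/eqP->//|].
  rewrite expn_eq0 => /andP[/eqP-> _]; by rewrite exp0n // muln0.
have n0 : 0 < n by apply: leq_trans hn; rewrite muln_gt0 /= muln_gt0 a0.
(* Cleared form of $(4n/s)(ads/n)^t \le s/n$; it is raised to the power $s$ at the end. *)
have base : 4 * n * (a * d * s) ^ t * n <= s * (n ^ t * s).
  case: t t0 hk ht {hb} => [|[|t]] // _ hk ht.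
    by move: ht a0; rewrite -mulnA -mulnn expn1; nia.
  rewrite !(expnSr _ t.+1) !(expnSr _ t) in ht *.
  have l1 : (a * d * s) ^ t * 2 ^ t <= n ^ t by rewrite -expnMn leq_expl // mulnC.
  have {ht}l2 : 4 * (a * d) ^ 2 <= 2 ^ t.
    by rewrite -(@leq_pmul2r 4) //; apply: leq_trans (leq_trans _ ht) _; rewrite -?mulnn; lia.
  set x := a * d in l1 l2 *.
  have l3 : 4 * x ^ 2 * (x * s) ^ t <= n ^ t.
    by apply: leq_trans l1; rewrite mulnC leq_mul2l l2 orbT.
  have -> : 4 * n * ((x * s) ^ t * (x * s) * (x * s)) * n = (4 * x ^ 2 * (x * s) ^ t) * (n * n *
    (s * s)).
    by rewrite -mulnn; lia.
  have -> : s * (n ^ t * n * n * s) = n ^ t * (n * n * (s * s)) by lia.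
  by rewrite leq_mul2r l3 orbT.
have ts0 : 0 < (t * s) ^ (t * s) by rewrite expn_gt0 muln_gt0 t0 s0.
have step : b * (n ^ t * s) ^ s <= (4 * n * (a * d * s) ^ t) ^ s * G.
  have -> : (n ^ t * s) ^ s = n ^ (t * s) * s ^ s by rewrite expnMn expnM.
  have -> : (4 * n * (a * d * s) ^ t) ^ s = (4 * n) ^ s * (a * d * s) ^ (t * s).
    by rewrite expnMn expnM.
  rewrite -(leq_pmul2r ts0).
  have h1 := bin_mul_self n s.
  have h2 : 'C('C(s, 2), t * s) * (t * s) ^ (t * s) <= (4 * (s * s)) ^ (t * s).
    apply: leq_trans (bin_mul_self _ _) _; apply: leq_expl; rewrite leq_mul2l /=.
    by rewrite bin2 -divn2; apply: leq_trans (leq_div _ _) _; rewrite leq_mul2l leq_pred orbT.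
  have h3 : (4 * (s * s)) ^ (t * s) * (2 * k) ^ (t * s) <= (a * d * s) ^ (t * s) * (t * s) ^ (t *
    s).
    rewrite -!expnMn; apply: leq_expl.
    have -> : 4 * (s * s) * (2 * k) = 8 * k * (s * s) by lia.
    have -> : a * d * s * (t * s) = a * d * t * (s * s) by lia.
    by rewrite leq_mul2r hk orbT.
  set m := t * s in hb h1 h2 h3 *.
  have -> : b * (n ^ m * s ^ s) * m ^ m = (b * n ^ m) * (s ^ s * m ^ m) by lia.
  apply: leq_trans (leq_mul hb (leqnn _)) _.
  have -> : 'C(n, s) * 'C('C(s, 2), m) * (2 * k) ^ m * G * (s ^ s * m ^ m) =
    ('C(n, s) * s ^ s) * (('C('C(s, 2), m) * m ^ m) * (2 * k) ^ m) * G by lia.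
  have -> : (4 * n) ^ s * (a * d * s) ^ m * G * m ^ m =
    (4 * n) ^ s * ((a * d * s) ^ m * m ^ m) * G by lia.
  rewrite leq_mul2r; apply/orP; right; apply: leq_mul => //.
  by apply: leq_trans h3; rewrite leq_mul2r h2 orbT.
have p0 : 0 < (n ^ t * s) ^ s by rewrite expn_gt0 muln_gt0 expn_gt0 n0 s0.
rewrite -(leq_pmul2r p0) mulnAC; apply: leq_trans (leq_mul step (leqnn _)) _.
rewrite mulnAC -expnMn [leqRHS]mulnAC -expnMn leq_mul2r.
by apply/orP; right; apply: leq_expl.
Qed.

(** From $s/n \le 1/2$ follows $(s/n)^s \le 2s/(2^s n)$, and $\sum_s 2s/2^s = 4$. *)
Lemma geometric_sum_bound (b : nat -> nat) n G L : 0 < n ->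
  (forall s, 0 < s <= L -> 2 * s <= n /\ b s * n ^ s <= s ^ s * G) ->
  n * \sum_(1 <= s < L.+1) b s <= 4 * G.
Proof.
move=> n0 h.
have term s : 0 < s <= L -> n * b s * 2 ^ s <= 2 * s * G.
  case: s => // s sL; have [h1 h2] := h s.+1 sL.
  have p0 : 0 < n ^ s by rewrite expn_gt0 n0.
  rewrite -(leq_pmul2r p0).
  have -> : n * b s.+1 * 2 ^ s.+1 * n ^ s = b s.+1 * n ^ s.+1 * 2 ^ s.+1 by rewrite !expnS; lia.
  apply: leq_trans (leq_mul h2 (leqnn _)) _.
  have -> : s.+1 ^ s.+1 * G * 2 ^ s.+1 = 2 * s.+1 * G * (2 * s.+1) ^ s.
    by rewrite expnMn !expnS; lia.
  by rewrite leq_mul2l leq_expl ?orbT.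
(* The exact partial sum $\sum_{s \le M} 2s/2^s = 4 - 2(M+2)/2^M$, multiplied by $2^M$. *)
have main : forall M, M <= L ->
    2 ^ M * (n * \sum_(1 <= s < M.+1) b s) + 2 * (M + 2) * G <= 4 * 2 ^ M * G.
  elim=> [|M IH] ML; first by rewrite big_geq // muln0; lia.
  have := term M.+1; rewrite ML => /(_ isT).
  rewrite big_nat_recr //= mulnDr expnS; have := IH (ltnW ML).
  set S := n * \sum_(_ <= _ < _) _; set x := n * b M.+1; set p := 2 ^ M; lia.
have := main L (leqnn L); have : 0 < 2 ^ L by rewrite expn_gt0.
set S := n * _; set p := 2 ^ L => p0 le; rewrite -(leq_pmul2l p0); lia.
Qed.

(** * Finite sets and double counting *)

Lemma leq_card_bigcup (I X : finType) (P : pred I) (A : I -> {set X}) (r : nat) :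
  (forall i, P i -> #|A i| <= r) -> #|\bigcup_(i | P i) A i| <= #|P| * r.
Proof.
move=> h; rewrite -sum_nat_const; elim/big_rec2: _ => [|i s x Pi le]; first by rewrite cards0.
by apply: leq_trans (leq_card_setU _ _) _; rewrite leq_add // h.
Qed.

Lemma exists_subset_card (X : finType) (B : {set X}) m : m <= #|B| ->
  exists2 A : {set X}, A \subset B & #|A| = m.
Proof.
rewrite -bin_gt0 -cards_draws => /card_gt0P[A]; rewrite inE => /andP[AB /eqP Am].
by exists A.
Qed.

Lemma card_pair (X Y : finType) (D : {set X * Y}) :
  #|D| = \sum_x #|[set y | (x, y) \in D]|.
Proof.
transitivity (\sum_x \sum_y ((x, y) \in D : nat)).
  by rewrite pair_bigA -sum1_card big_mkcond /=; apply: eq_bigr => -[x y] _ /=; case: ifP.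
by apply: eq_bigr => x _; rewrite -sum1_card [RHS]big_mkcond /=; apply: eq_bigr => y _;
  rewrite inE; case: ifP.
Qed.

Lemma card_pair_geq (X Y : finType) (D : {set X * Y}) (A : {set X}) (r : nat) :
  (forall x, x \in A -> r <= #|[set y | (x, y) \in D]|) -> #|A| * r <= #|D|.
Proof.
move=> h; rewrite -sum_nat_const card_pair big_mkcond /=.
by apply: leq_sum => x _; case: ifP => // /h.
Qed.

Lemma card_pair_leq (X Y : finType) (D : {set X * Y}) (A : {set X}) (r : nat) :
  (forall x y, (x, y) \in D -> x \in A) ->
  (forall x, x \in A -> #|[set y | (x, y) \in D]| <= r) -> #|D| <= #|A| * r.
Proof.
move=> hA h; rewrite -sum_nat_const card_pair [leqRHS]big_mkcond /=.
apply: leq_sum => x _; case: ifP => [/h //|hx].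
rewrite leqn0 cards_eq0; apply/eqP/setP => y; rewrite !inE.
by apply/negbTE/negP => /hA; rewrite hx.
Qed.

Lemma card_pair_leq2 (X Y : finType) (D : {set X * Y}) (A : {set Y}) (r : nat) :
  (forall x y, (x, y) \in D -> y \in A) ->
  (forall y, y \in A -> #|[set x | (x, y) \in D]| <= r) -> #|D| <= #|A| * r.
Proof.
move=> hA h.
have inj : injective (fun q : X * Y => (q.2, q.1)).
  by case=> [a b] [c e] /= [-> ->].
rewrite -(card_imset (mem D) inj).
apply: card_pair_leq => [y x|y /h].
  by case/imsetP => -[x' y'] /= hD [-> _]; apply: hA hD.
apply: leq_trans; apply: subset_leq_card; apply/subsetP => x; rewrite !inE.
by case/imsetP => -[x' y'] /= hD [-> ->].
Qed.

(** The map sending $(x,i)$ to [(f x i, i)] is injective because it keeps the label $i$. In the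
    applications [f] is a switching, $i$ records the vertices chosen for it, [W] holds the
    admissible moves and [W'] a superset of their reversals. *)
Lemma double_counting (X Y I : finType) (A : {set X}) (B : {set Y})
    (W : {set X * I}) (W' : {set Y * I}) (f : X -> I -> Y) (p r : nat) :
  (forall x i, x \in A -> (x, i) \in W -> f x i \in B /\ (f x i, i) \in W') ->
  (forall x x' i, x \in A -> x' \in A -> (x, i) \in W -> (x', i) \in W ->
     f x i = f x' i -> x = x') ->
  (forall x, x \in A -> p <= #|[set i | (x, i) \in W]|) ->
  (forall y, y \in B -> #|[set i | (y, i) \in W']| <= r) ->
  #|A| * p <= #|B| * r.
Proof.
move=> hf finj hp hr.
pose D := [set q in W | q.1 \in A].
apply: (@leq_trans #|D|).
  apply: card_pair_geq => x xA; apply: leq_trans (hp x xA) _.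
  by apply: subset_leq_card; apply/subsetP => i; rewrite !inE /= xA andbT.
have -> : #|D| = #|[set (f q.1 q.2, q.2) | q in D]|.
  rewrite card_in_imset // => -[x i] [x' i']; rewrite !inE /=.
  move=> /andP[h1 h2] /andP[h3 h4] [e1 e2]; rewrite -e2 in e1 h3 *.
  by congr pair; apply: finj e1.
apply: (@card_pair_leq _ _ _ B) => [y i|y yB].
  case/imsetP => -[x j]; rewrite inE /= => /andP[h1 h2] [-> _].
  by have [] := hf x j h2 h1.
apply: leq_trans (hr y yB); apply: subset_leq_card; apply/subsetP => i.
rewrite !inE => /imsetP[[x j]]; rewrite inE /= => /andP[h1 h2] [-> ->].
by have [] := hf x j h2 h1.
Qed.

(** * Lovász local lemma in a finite product space *)

Section LocalLemma.
Variables (T C : finType).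
Implicit Types (f g : {ffun T -> C}) (X Y : {set {ffun T -> C}}) (V : {set T}).

Definition depends_on V X :=
  forall f g, (forall v, v \in V -> f v = g v) -> (f \in X) = (g \in X).

(* Exchanging the coordinates in V between the two components is an involution
   of the pairs of functions. *)
Lemma depends_on_independent V W X Y : depends_on V X -> depends_on W Y ->
  [disjoint V & W] -> #|X :&: Y| * #|{ffun T -> C}| = #|X| * #|Y|.
Proof.
move=> dX dY dVW.
pose h (q : {ffun T -> C} * {ffun T -> C}) :=
  ([ffun v => if v \in V then q.1 v else q.2 v],
   [ffun v => if v \in V then q.2 v else q.1 v]).
have hK : involutive h.
  by case=> f g; rewrite /h /=; congr pair; apply/ffunP => v; rewrite !ffunE; case: (v \in V).
rewrite -(cardsT {ffun T -> C}) -!cardsX -(card_imset _ (inv_inj hK)).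
apply: eq_card => q; rewrite -{1}(hK q) mem_imset; last exact: inv_inj hK.
rewrite !inE /= andbT; congr andb.
  by apply: dX => v vV; rewrite ffunE vV.
apply: dY => v vW; rewrite ffunE ifN //.
by apply: contraTN vW => /(disjointFr dVW) ->.
Qed.

Variables (I : finType) (vb : I -> {set T}) (B : I -> {set {ffun T -> C}}) (D : nat).
Hypothesis B_dep : forall i, depends_on (vb i) (B i).
Hypothesis vb_degree : forall i, #|[set j | ~~ [disjoint vb j & vb i]]| <= D.
Hypothesis B_small : forall i, 4 * D * #|B i| <= #|{ffun T -> C}|.
Hypothesis D_gt0 : 0 < D.
Implicit Types S : {set I}.

Definition avoiding (S : {set I}) : {set {ffun T -> C}} :=
  [set f | [forall i in S, f \notin B i]].

Lemma depends_on_avoiding S (V : {set T}) :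
  (forall i, i \in S -> [disjoint vb i & V]) -> depends_on (~: V) (avoiding S).
Proof.
move=> hS f g fg; rewrite !inE; apply: eq_forallb => i.
case iS: (i \in S) => //=; congr negb; apply: B_dep => v vi.
by apply: fg; rewrite inE (disjointFr (hS i iS) vi).
Qed.

Lemma avoiding_sub S S' : S \subset S' -> avoiding S' \subset avoiding S.
Proof.
move=> /subsetP sS; apply/subsetP => f; rewrite !inE => /forall_inP h.
by apply/forall_inP => i /sS /h.
Qed.

(** Conditional form of the symmetric local lemma, by induction on $|S|$. Given that the events of
    [S2], which share no coordinate with [B i], are avoided, [B i] still has probability at most
    $1/(4D)$. Each of the at most $D$ events of [S1] has conditional probability at most $1/(2D)$ by
    induction, so all are avoided with probability at least $1/2$. The quotient is $1/(2D)$. *)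
Lemma avoiding_ratio S i : 2 * D * #|B i :&: avoiding S| <= #|avoiding S|.
Proof.
have [m] := ubnP #|S|; elim: m => // m IH in S i *; rewrite ltnS => Sm.
pose S1 := [set j in S | ~~ [disjoint vb j & vb i]].
pose S2 := [set j in S | [disjoint vb j & vb i]].
have far : 4 * D * #|B i :&: avoiding S2| <= #|avoiding S2|.
  have dep : depends_on (~: vb i) (avoiding S2).
    by apply: depends_on_avoiding => j; rewrite inE => /andP[].
  have := depends_on_independent (@B_dep i) dep.
  rewrite -setI_eq0 setICr eqxx => /(_ isT) indep.
  have [f0|f0] := posnP #|{ffun T -> C}|.
    rewrite (leq_trans _ (leq0n _)) // leqn0 muln_eq0 -leqn0 -[X in _ || X]leqn0.
    by rewrite -f0 -[X in X <= _]addn0 orbC max_card.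
  rewrite -(leq_pmul2r f0) -mulnA indep mulnA mulnC leq_mul2l.
  by rewrite B_small orbT.
have sub : avoiding S \subset avoiding S2.
  by apply: avoiding_sub; apply/subsetP => j; rewrite inE => /andP[].
have BS : #|B i :&: avoiding S| <= #|B i :&: avoiding S2|.
  exact/subset_leq_card/setIS.
have half : #|avoiding S2| <= 2 * #|avoiding S|.
  (* If [S1] is empty then [S2 = S], and the induction hypothesis would not apply to [S2]. *)
  have [S10|[j0 j0S]] := set_0Vmem S1.
    suff <- : S = S2 by rewrite leq_pmull.
    apply/setP => j; rewrite inE; case jS: (j \in S) => //=.
    by apply/esym/negPn/negP => jd; move/setP/(_ j): S10; rewrite !inE jS jd.
  have S2m : #|S2| < m.
    apply: leq_trans Sm; apply: proper_card; apply/properP; split.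
      by apply/subsetP => j; rewrite inE => /andP[].
    by case/setIdP: j0S => jS jd; exists j0; rewrite // inE (negbTE jd) andbF.
  have cover : avoiding S2 \subset avoiding S :|: \bigcup_(j in S1) (B j :&: avoiding S2).
    apply/subsetP => f fS2; rewrite inE; case: (boolP (f \in avoiding S)) => //=.
    rewrite inE negb_forall => /existsP[j]; rewrite negb_imply negbK => /andP[jS fj].
    apply/bigcupP; exists j; last by rewrite inE fj.
    rewrite inE jS /=; apply/negP => jd; move: fS2; rewrite inE => /forall_inP/(_ j).
    by rewrite inE jS jd fj => /(_ isT).
  have le1 : #|avoiding S2| <= #|avoiding S| + \sum_(j in S1) #|B j :&: avoiding S2|.
    apply: leq_trans (subset_leq_card cover) _.
    apply: leq_trans (leq_card_setU _ _) _; rewrite leq_add2l.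
    elim/big_rec2: _ => [|j s x _ le]; first by rewrite cards0.
    by apply: leq_trans (leq_card_setU _ _) _; rewrite leq_add2l.
  have le2 : 2 * D * (\sum_(j in S1) #|B j :&: avoiding S2|) <= D * #|avoiding S2|.
    rewrite big_distrr /=; apply: leq_trans (_ : #|S1| * #|avoiding S2| <= _).
      by rewrite -sum_nat_const; apply: leq_sum => j _; apply: IH.
    rewrite leq_mul2r; apply/orP; right; apply: leq_trans (vb_degree i).
    by apply: subset_leq_card; apply/subsetP => j; rewrite !inE => /andP[].
  rewrite -(leq_pmul2l D_gt0); nia.
by rewrite -(@leq_pmul2l 2) //; nia.
Qed.

(** Adding one more event to those avoided removes at most half of the remaining functions, by
    [avoiding_ratio], so some function always survives. *)
Theorem local_lemma : 0 < #|{ffun T -> C}| -> exists f, forall i, f \notin B i.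
Proof.
move=> F_gt0.
suff pos S : 0 < #|avoiding S|.
  have /card_gt0P[f] := pos setT; rewrite inE => /forall_inP h.
  by exists f => i; apply: h; rewrite inE.
have [m] := ubnP #|S|; elim: m => // m IH in S *; rewrite ltnS => Sm.
have [->|[i iS]] := set_0Vmem S.
  rewrite (_ : avoiding set0 = setT) ?cardsT //; apply/setP => f; rewrite !inE.
  by apply/forall_inP => j; rewrite inE.
have lt0 : 0 < #|avoiding (S :\ i)|.
  by apply: IH; move: Sm; rewrite (cardsD1 i) iS.
have := avoiding_ratio (S :\ i) i.
have -> : avoiding S = avoiding (S :\ i) :\: B i.
  apply/setP => f; rewrite !inE; apply/forall_inP/andP => [h|[fi /forall_inP h] j jS].
    by split; [exact: h|apply/forall_inP => j; rewrite !inE => /andP[_ /h]].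
  by have [->//|ji] := eqVneq j i; apply: h; rewrite !inE ji.
rewrite cardsD setIC; nia.
Qed.
End LocalLemma.

(** * Colourings with many neighbours of every colour *)

Section Colouring.
Variables (T C : finType) (N : {set T}) (i : C).

(* Exponential moment bound, for the weight [2 ^ (number of vertices of N not coloured i)]. *)
Lemma few_coloured_bound m : m <= #|N| ->
  #|[set f : {ffun T -> C} | #|[set v in N | f v == i]| < m]| * 2 ^ (#|N| - m) * #|C| ^ #|N|
    <= #|C| ^ #|T| * (2 * #|C|).-1 ^ #|N|.
Proof.
move=> mN.
pose w (v : T) (c : C) := if (v \in N) && (c != i) then 2 else 1.
have C_gt0 : 0 < #|C| by apply/card_gt0P; exists i.
(* The sum of products factors over the vertices: a vertex of [N] contributes $2|C|-1$, any other
   vertex $|C|$. *)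
have wE : \sum_(f : {ffun T -> C}) \prod_v w v (f v) * #|C| ^ #|N|
          = #|C| ^ #|T| * (2 * #|C|).-1 ^ #|N|.
  rewrite -big_distrl /=; rewrite -(bigA_distr_bigA w).
  have eqw v : \sum_c w v c = if v \in N then (2 * #|C|).-1 else #|C|.
    rewrite /w; case: ifP => vN /=; last by rewrite sum1_card.
    rewrite (bigD1 i) //= eqxx /= (eq_bigr (fun=> 2)); last by move=> c ->.
    rewrite sum_nat_const; have := cardC1 i; rewrite [#|predC1 i|](@eq_card _ _ (predC1 i)) //;
      move=> ->.
    by case: #|C| C_gt0 => // c _; lia.
  rewrite (eq_bigr _ (fun v _ => eqw v)) (bigID (mem N)) /=.
  rewrite (eq_bigr (fun=> (2 * #|C|).-1)); last by move=> v ->.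
  rewrite [X in _ * X * _](eq_bigr (fun=> #|C|)); last by move=> v /negbTE ->.
  rewrite !prod_nat_const -mulnA -expnD mulnC; congr (_ ^ _ * _).
  by rewrite addnC -(cardC (mem N)).
rewrite -wE -big_distrl /= leq_mul2r; apply/orP; right.
rewrite -sum_nat_const [leqRHS](bigID (mem [set f : {ffun T -> C} | #|[set v in N | f v == i]| <
  m])) /=.
apply: leq_trans (leq_addr _ _); apply: leq_sum => f; rewrite inE => fm.
rewrite (bigID (fun v => (v \in N) && (f v != i))) /= (eq_bigr (fun=> 2)); last by move=> v;
  rewrite /w => ->.
rewrite prod_nat_const [X in _ * X]big1 ?muln1; last by move=> v /negbTE; rewrite /w => ->.
rewrite leq_exp2l // leq_subLR.
have <- : #|[set v in N | f v == i]| + #|[set v in N | f v != i]| = #|N|.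
  by rewrite -[RHS](cardsID [set v | f v == i]); congr addn; apply: eq_card => v;
    rewrite !inE // andbC.
by rewrite leq_add ?(ltnW fm) // cardsE.
Qed.
End Colouring.

(** This is $(1-1/a)^a \le 1/2$. The inner [step] is Bernoulli's inequality $(1+1/a)^b \ge 1+b/a$
    with denominators cleared. *)
Lemma bernoulli_bound a : 0 < a -> 2 * a.-1 ^ a <= a ^ a.
Proof.
case: a => // a _ /=; have step b : a ^ b * (a + b) <= a * a.+1 ^ b.
  elim: b => [|b IH]; first by rewrite !expn0 mul1n muln1 addn0.
  rewrite expnSr [a.+1 ^ b.+1]expnS; nia.
case: a => [|a] in step *; first by [].
have := step a.+2; rewrite [a.+1 ^ a.+2]expnS; nia.
Qed.

(** Among the $k$ factors $1-1/(2d)$ there are $8t$ blocks of length $2d$, and each block is at most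
    $1/2$. *)
Lemma near_colour_bound d k t : 0 < d -> 16 * d * t <= k ->
  (2 * d).-1 ^ k * 2 ^ (8 * t) <= 2 ^ k * d ^ k.
Proof.
move=> d0; have -> : 16 * d * t = (2 * d) * (8 * t) by lia.
move: (8 * t) => e tk; rewrite -expnMn -(subnKC tk) !expnD mulnAC.
apply: leq_mul; last by apply: leq_expl; rewrite leq_pred.
by rewrite !(expnM _ (2 * d)) -expnMn mulnC leq_expl // bernoulli_bound // muln_gt0.
Qed.

(** Local lemma with one bad event per vertex $v$: some colour occurs fewer than $2t$ times on
    [N v]. It has probability at most $d 2^{-6t}$ and depends only on the colours on [N v], which
    meets at most $k^2$ of the sets [N u]. *)
Theorem balanced_colouring (T : finType) (N : T -> {set T}) d k t :
  0 < d -> 16 * d * t <= k -> 4 * k ^ 2 * d <= 2 ^ (6 * t) ->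
  (forall v, #|N v| = k) -> (forall w, #|[set v | w \in N v]| <= k) ->
  exists f : {ffun T -> 'I_d}, forall v i, 2 * t <= #|[set w in N v | f w == i]|.
Proof.
move=> d0 tk big cN cN'.
have [k0|k0] := posnP k.
  exists [ffun=> Ordinal d0] => v i; suff -> : t = 0 by [].
  move: tk; rewrite k0 leqn0 !muln_eq0; lia.
pose B v : {set {ffun T -> 'I_d}} :=
  \bigcup_i [set f : {ffun T -> 'I_d} | #|[set w in N v | f w == i]| < 2 * t].
have [||||| f fB] := @local_lemma T 'I_d T N B (k * k).
- move=> v f g fg; apply/bigcupP/bigcupP => -[i _]; rewrite inE => h; exists i => //;
    rewrite inE; apply: leq_ltn_trans h; apply: subset_leq_card; apply/subsetP => w;
    by rewrite !inE => /andP[wN]; rewrite wN /= fg.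
- move=> v; apply: leq_trans (_ : #|\bigcup_(w in N v) [set u | w \in N u]| <= _).
    apply: subset_leq_card; apply/subsetP => u; rewrite inE => /pred0Pn[w] /andP[/= wu wv].
    by apply/bigcupP; exists w; rewrite ?inE.
  rewrite -{1}(cN v) -sum_nat_const; elim/big_rec2: _ => [|w s x _ le]; first by rewrite cards0.
  by apply: leq_trans (leq_card_setU _ _) _; rewrite leq_add.
- move=> v; have le1 : #|B v| <= \sum_(i < d) #|[set f : {ffun T -> 'I_d} | #|[set w in N v | f w
  == i]| < 2 * t]|.
    rewrite /B; elim/big_rec2: _ => [|w s x _ le]; first by rewrite cards0.
    by apply: leq_trans (leq_card_setU _ _) _; rewrite leq_add.
  have le2 i : #|[set f : {ffun T -> 'I_d} | #|[set w in N v | f w == i]| < 2 * t]| * 2 ^ (6 * t)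
    <= d ^ #|T|.
    have mk : 2 * t <= k by apply: leq_trans tk; rewrite leq_mul2r; lia.
    have := @few_coloured_bound T 'I_d (N v) i (2 * t); rewrite cN card_ord => /(_ mk).
    have := near_colour_bound d0 tk.
    (* Of the gain $2^{8t}$ in [near_colour_bound], a factor $2^{2t}$ is lost because
       [few_coloured_bound] only provides $2^{k-2t}$. *)
    have -> : 2 ^ (8 * t) = 2 ^ (2 * t) * 2 ^ (6 * t) by rewrite -expnD -mulnDl.
    have -> : 2 ^ k = 2 ^ (2 * t) * 2 ^ (k - 2 * t) by rewrite -expnD subnKC.
    move: (#|_|) => X.
    have : 0 < 2 ^ (k - 2 * t) * d ^ k * 2 ^ (2 * t) by rewrite !muln_gt0 !expn_gt0 d0.
    set a := 2 ^ (2 * t); set b := 2 ^ (6 * t); set c := 2 ^ (k - 2 * t).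
    set e := d ^ k; set g := (2 * d).-1 ^ k; set h := d ^ _.
    move=> pos l1 l2; rewrite -(leq_pmul2r pos).
    have -> : X * b * (c * e * a) = (X * c * e) * (a * b) by lia.
    apply: leq_trans (leq_mul l2 (leqnn _)) _.
    have -> : h * (c * e * a) = h * (a * c * e) by lia.
    by rewrite -mulnA leq_mul2l l1 orbT.
  rewrite card_ffun card_ord.
  have : #|B v| * 2 ^ (6 * t) <= d * d ^ #|T|.
    apply: leq_trans (leq_mul le1 (leqnn _)) _; rewrite big_distrl /=.
    apply: leq_trans (leq_sum _ (fun i _ => le2 i)) _.
    by rewrite sum_nat_const card_ord.
  have : 0 < 2 ^ (6 * t) by rewrite expn_gt0.
  move: big; set b := 2 ^ _; set h := d ^ _; move: (#|B v|) => X le3 b0 le4.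
  rewrite -(leq_pmul2r d0); rewrite -mulnn in le3.
  apply: leq_trans (_ : X * b <= _); last by rewrite [h * d]mulnC.
  have -> : 4 * (k * k) * X * d = X * (4 * (k * k) * d) by lia.
  by rewrite leq_mul2l le3 orbT.
- by rewrite muln_gt0 k0.
- by rewrite card_ffun card_ord expn_gt0 d0.
exists f => v i; rewrite leqNgt; apply/negP => h; move: (fB v) => /negP; apply.
by apply/bigcupP; exists i => //; rewrite inE.
Qed.

(** * Switchings of regular graphs *)

Section Switch.
Variables (T : finType) (k : nat).
Implicit Types (E F : {set {set T}}) (x y a b c e : T).

Definition k_regular_graphs : {set {set {set T}}} :=
  [set E | simple_graph E && k_regular k E].

Lemma adjacentC E x y : adjacent_vertices E x y = adjacent_vertices E y x.
Proof. by rewrite /adjacent_vertices setUC. Qed.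

Lemma adjacent_neq E x y : simple_graph E -> adjacent_vertices E x y -> x != y.
Proof.
move=> /forall_inP sE /sE; apply: contraTneq => ->.
by rewrite setUid cards1.
Qed.

Lemma set2_inj x y z : [set x; y] = [set x; z] -> y = z.
Proof.
move=> h.
have: y \in [set x; z] by rewrite -h !inE eqxx orbT.
have: z \in [set x; y] by rewrite h !inE eqxx orbT.
by rewrite !inE => /orP[/eqP->|/eqP->] // /orP[/eqP|/eqP] ->.
Qed.

Lemma eq_set2 x y z w :
  ([set x; y] == [set z; w]) = ((x == z) && (y == w)) || ((x == w) && (y == z)).
Proof.
apply/eqP/orP => [h|[/andP[/eqP-> /eqP->]|/andP[/eqP-> /eqP->]]] //; last by rewrite setUC.
have: x \in [set z; w] by rewrite -h !inE eqxx.
rewrite !inE => /orP[] /eqP xE; subst x.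
  by left; rewrite eqxx; apply/eqP/set2_inj/h.
by right; rewrite eqxx; apply/eqP; rewrite (setUC [set z]) in h; apply/set2_inj/h.
Qed.

Lemma card_incident E x (A : {set T}) : simple_graph E ->
  #|[set y in A | adjacent_vertices E x y]| =
  #|[set e in E | (x \in e) && (e :\ x \subset A)]|.
Proof.
move=> sE; have inj : injective (fun y => [set x; y]) by move=> y z /set2_inj.
rewrite -(card_imset _ inj); apply: eq_card => g; rewrite !inE.
apply/imsetP/idP => [[y]|/and3P[gE xg gA]].
  rewrite inE /adjacent_vertices => /andP[yA xy] ->; rewrite xy !inE eqxx /=.
  apply/subsetP => z; rewrite !inE => /andP[/negbTE -> /= /eqP ->] //.
have /cards2P[y [z [yz gE']]] := forall_inP sE g gE; subst g.
have [w xw gE'] : exists2 w, x != w & [set y; z] = [set x; w].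
  move: xg; rewrite !inE => /orP[/eqP ->|/eqP ->]; first by exists z.
  by exists y; rewrite 1?eq_sym // setUC.
rewrite gE' in gE gA *; exists w => //; rewrite inE /adjacent_vertices gE andbT.
by apply: (subsetP gA); rewrite !inE eqxx orbT eq_sym xw.
Qed.

Lemma degreeE E x : simple_graph E ->
  #|[set y | adjacent_vertices E x y]| = \sum_(e in E) (x \in e).
Proof.
move=> sE; have := card_incident x setT sE.
rewrite (eq_card (B := [set y | adjacent_vertices E x y])); last by move=> y; rewrite !inE.
move=> ->; rewrite -sum1_card big_mkcond /= [RHS]big_mkcond /=.
by apply: eq_bigr => e _; rewrite !inE subsetT andbT; case: (e \in E); case: (x \in e).
Qed.

Definition switch E a b c e : {set {set T}} :=
  (E :\: [set [set a; b]; [set c; e]]) :|: [set [set a; c]; [set b; e]].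

(** In a simple graph this makes all four vertices distinct: [a = e] or [b = c] would make [a] and
    [c] adjacent. *)
Definition switchable E a b c e : bool :=
  [&& adjacent_vertices E a b, adjacent_vertices E c e,
      ~~ adjacent_vertices E a c, ~~ adjacent_vertices E b e, a != c & b != e].

(** Exchanging the roles of [b] and [c] reverses a switching; hence for fixed labels it is injective
    in the graph, as [double_counting] requires. *)
Lemma switchK E a b c e : switchable E a b c e ->
  switch (switch E a b c e) a c b e = E.
Proof.
rewrite /switchable /adjacent_vertices => /and5P[h1 h2 h3 h4 _]; apply/setP => g.
rewrite !inE; have [->|_] := eqVneq g [set a; b]; first by rewrite h1 /= orbT.
have [->|_] := eqVneq g [set c; e]; first by rewrite h2 !orbT.
have [->|_] := eqVneq g [set a; c]; first by rewrite (negbTE h3).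
by have [->|_] := eqVneq g [set b; e]; rewrite ?(negbTE h4) ?orbF.
Qed.

Lemma switch_regular E a b c e : E \in k_regular_graphs -> switchable E a b c e ->
  switch E a b c e \in k_regular_graphs.
Proof.
rewrite inE => /andP[sE rE] sw.
have sE' : simple_graph (switch E a b c e).
  apply/forall_inP => g; rewrite !inE => /orP[/andP[_ /(forall_inP sE)] //|].
  by case/and5P: sw => _ _ _ _ /andP[h1 h2]; case/orP => /eqP ->; rewrite cards2 ?h1 ?h2.
rewrite inE sE' /=; apply/forallP => x; have := forallP rE x.
rewrite !degreeE // => /eqP <-; apply/eqP.
case/and5P: sw; rewrite /adjacent_vertices => h1 h2 h3 h4 /andP[ac be].
have ab : [set a; b] != [set a; c] by apply: contraNneq h3 => <-.
have ab' : [set a; b] != [set b; e] by apply: contraNneq h4 => <-.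
have ce : [set c; e] != [set a; c] by apply: contraNneq h3 => <-.
have ce' : [set c; e] != [set b; e] by apply: contraNneq h4 => <-.
have nab := adjacent_neq sE h1; have nce := adjacent_neq sE h2.
have nae : a != e by apply: contraNneq h3 => ->; rewrite setUC.
have nbc : b != c by apply: contraNneq h3 => <-.
have abce : [set a; b] != [set c; e] by rewrite eq_set2 negb_or !negb_and ac nae.
have acbe : [set a; c] != [set b; e] by rewrite eq_set2 negb_or !negb_and nab nae.
(* Degrees are sums over edges. The edges common to both graphs cancel, and the removed pair and the
   added pair each cover [a], [b], [c], [e] exactly once. *)
rewrite [LHS](big_setID [set [set a; c]; [set b; e]]) /=.
have -> : switch E a b c e :&: [set [set a; c]; [set b; e]] = [set [set a; c]; [set b; e]].
  exact/setIidPr/subsetUr.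
have -> : switch E a b c e :\: [set [set a; c]; [set b; e]] =
          E :\: [set [set a; b]; [set c; e]].
  rewrite setDUl setDv setU0; apply/setDidPl; rewrite disjoint_sym disjoints_subset.
  apply/subsetP => g; rewrite !inE.
  by case/orP => /eqP ->; rewrite ?(negbTE h3) ?(negbTE h4) andbF.
rewrite [RHS](big_setID [set [set a; b]; [set c; e]]) /=; congr addn.
have -> : E :&: [set [set a; b]; [set c; e]] = [set [set a; b]; [set c; e]].
  by apply/setIidPr/subsetP => g; rewrite !inE => /orP[] /eqP ->.
rewrite !big_setU1 ?inE // !big_set1 !inE.
have [->|xa] := eqVneq x a.
  by rewrite (negbTE nab) (negbTE ac) (negbTE nae).
have [->|xb] := eqVneq x b.
  by rewrite (negbTE nbc) (negbTE be).
by have [->|xc] := eqVneq x c; rewrite ?(negbTE nce).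
Qed.

Lemma handshake F : simple_graph F ->
  #|[set q : T * T | adjacent_vertices F q.1 q.2]| = 2 * #|F|.
Proof.
move=> sF; rewrite card_pair.
rewrite (eq_bigr (fun x => \sum_(e in F) (x \in e))); last first.
  by move=> x _; rewrite -degreeE //; apply: eq_card => y; rewrite !inE.
rewrite exchange_big /= mulnC -sum_nat_const; apply: eq_bigr => e eF.
by rewrite -(eqP (forall_inP sF e eF)) -sum1_card [RHS]big_mkcond.
Qed.

Lemma card_adjacent E : E \in k_regular_graphs ->
  forall x, #|[set y | adjacent_vertices E x y]| = k.
Proof. by rewrite inE => /andP[_ /forallP rE] x; apply/eqP. Qed.

Lemma card_adjacent_pairs E (A : {set T}) : E \in k_regular_graphs ->
  #|[set q : T * T | (q.1 \in A) && adjacent_vertices E q.1 q.2]| = #|A| * k.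
Proof.
move=> gE; rewrite card_pair -sum_nat_const [RHS]big_mkcond /=.
apply: eq_bigr => x _; case: ifP => xA.
  by rewrite -(card_adjacent gE x); apply: eq_card => y; rewrite !inE /= xA.
by apply: eq_card0 => y; rewrite !inE /= xA.
Qed.

Lemma card_all_adjacent_pairs E : E \in k_regular_graphs ->
  #|[set q : T * T | adjacent_vertices E q.1 q.2]| = #|T| * k.
Proof.
move=> gE; rewrite -cardsT -(card_adjacent_pairs setT gE).
by apply: eq_card => q; rewrite !inE.
Qed.

(* Pairs [(c, e)] of adjacent vertices with which the edge [ab] can be switched. *)
Lemma card_far_pairs E (Q : {set T * T}) a b : E \in k_regular_graphs ->
  (forall q, q \in Q -> adjacent_vertices E q.1 q.2) ->
  #|Q| - 2 * k.+1 * k <=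
  #|[set q in Q | [&& ~~ adjacent_vertices E a q.1, ~~ adjacent_vertices E b q.2,
                      a != q.1 & b != q.2]]|.
Proof.
move=> gE hQ; set P := [set q in Q | _].
(* A pair is unusable only if its first vertex lies in the closed neighbourhood of [a] or its second
   in that of [b]. *)
pose N x := x |: [set y | adjacent_vertices E x y].
have cN x : #|N x| <= k.+1.
  by rewrite /N cardsU1 (card_adjacent gE) -[k.+1]add1n leq_add2r leq_b1.
have l1 : #|[set q in Q | q.1 \in N a]| <= k.+1 * k.
  apply: leq_trans (_ : #|N a| * k <= _); last by rewrite leq_mul2r cN orbT.
  apply: card_pair_leq => [x y|x _]; first by rewrite inE => /andP[].
  rewrite -[leqRHS](card_adjacent gE x); apply: subset_leq_card; apply/subsetP => y.
  by rewrite !inE /= => /andP[/hQ].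
have l2 : #|[set q in Q | q.2 \in N b]| <= k.+1 * k.
  apply: leq_trans (_ : #|N b| * k <= _); last by rewrite leq_mul2r cN orbT.
  apply: card_pair_leq2 => [x y|y _]; first by rewrite inE => /andP[].
  rewrite -[leqRHS](card_adjacent gE y); apply: subset_leq_card; apply/subsetP => x.
  by rewrite !inE /= => /andP[/hQ]; rewrite adjacentC.
have cover : Q \subset P :|: ([set q in Q | q.1 \in N a] :|: [set q in Q | q.2 \in N b]).
  apply/subsetP => q qQ; rewrite !inE qQ /= (eq_sym a) (eq_sym b).
  case: (adjacent_vertices E a _); case: (adjacent_vertices E b _);
    by case: (q.1 == a); case: (q.2 == b).
rewrite leq_subLR addnC; apply: leq_trans (subset_leq_card cover) _.
apply: leq_trans (leq_card_setU _ _) _; rewrite leq_add2l.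
apply: leq_trans (leq_card_setU _ _) _.
by rewrite -mulnA mul2n -addnn leq_add.
Qed.

Definition containing (F : {set {set T}}) := [set E in k_regular_graphs | F \subset E].

(** The edge $g = ab$ is switched away with a pair $(c,e)$ whose edge is not in $F$, so the rest of
    $F$ survives. To reverse, $c$ is a neighbour of $a$ and $e$ one of $b$, which leaves $k^2$
    choices. *)
Lemma containing_switch F (g : {set T}) : g \in F -> simple_graph F ->
  #|containing F| * (#|T| * k - 2 * k.+1 * k - 2 * #|F|) <=
  #|containing (F :\ g)| * k ^ 2.
Proof.
move=> gF sF; have /cards2P[a [b [ab gE]]] := forall_inP sF g gF; subst g.
pose W := [set q : {set {set T}} * (T * T) |
  switchable q.1 a b q.2.1 q.2.2 && ([set q.2.1; q.2.2] \notin F)].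
pose W' := [set q : {set {set T}} * (T * T) |
  adjacent_vertices q.1 a q.2.1 && adjacent_vertices q.1 b q.2.2].
apply: (@double_counting _ _ (T * T)%type _ _ W W' (fun E q => switch E a b q.1 q.2)).
- move=> E [c e]; rewrite inE => /andP[gE FE]; rewrite inE /= => /andP[sw ceF].
  split; last by rewrite inE /adjacent_vertices !inE !eqxx !orbT.
  rewrite inE (switch_regular gE sw) /=; apply/subsetP => h; rewrite !inE => /andP[hg hF].
  rewrite (subsetP FE _ hF) andbT negb_or hg /=.
  by rewrite (_ : h != _) //; apply: contraNneq ceF => <-.
- move=> E E' [c e] _ _; rewrite !inE /= => /andP[sw _] /andP[sw' _] h.
  by rewrite -(switchK sw) -(switchK sw') h.
- move=> E; rewrite inE => /andP[gE FE].
  have abE : adjacent_vertices E a b by apply: (subsetP FE).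
  pose Q := [set q : T * T | adjacent_vertices E q.1 q.2 && ([set q.1; q.2] \notin F)].
  have cQ : #|T| * k - 2 * #|F| <= #|Q|.
    rewrite -(card_all_adjacent_pairs gE) leq_subLR.
    rewrite -(handshake sF); apply: leq_trans (leq_card_setU _ _).
    apply: subset_leq_card; apply/subsetP => q; rewrite !inE => ->.
    by rewrite /adjacent_vertices orbN.
  have hQ q : q \in Q -> adjacent_vertices E q.1 q.2 by rewrite inE => /andP[].
  have := card_far_pairs a b gE hQ; rewrite subnAC.
  move=> h; apply: leq_trans (leq_trans (leq_sub2r _ cQ) h) _.
  apply: subset_leq_card; apply/subsetP => -[c e]; rewrite !inE /switchable /= abE.
  by case/andP => /andP[-> ->] /and4P[-> -> -> ->].
- move=> E; rewrite inE => /andP[gE _].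
  have -> : k ^ 2 = #|[set c | adjacent_vertices E a c]| * #|[set e | adjacent_vertices E b e]|.
    by rewrite !card_adjacent // mulnn.
  rewrite -cardsX.
  by apply: subset_leq_card; apply/subsetP => q; rewrite !inE.
Qed.

(** The edges of $F$ are removed one at a time. The size condition leaves at least $nk/2$ forward
    switchings against $k^2$ backward ones, a factor $2k/n$ per edge. *)
Lemma card_containing F : simple_graph F -> 4 * #|F| + 4 * k.+1 * k <= #|T| * k ->
  #|containing F| * #|T| ^ #|F| <= (2 * k) ^ #|F| * #|k_regular_graphs|.
Proof.
have [m] := ubnP #|F|; elim: m => // m IH in F *; rewrite ltnS => Fm sF le.
have [->|[g gF]] := set_0Vmem F.
  by rewrite cards0 !expn0 muln1 mul1n subset_leq_card //; apply/subsetP => E;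
    rewrite inE => /andP[].
have sF' : simple_graph (F :\ g).
  by apply/forall_inP => e; rewrite !inE => /andP[_ /(forall_inP sF)].
have cF : #|F| = #|F :\ g|.+1 by rewrite (cardsD1 g) gF.
have := IH (F :\ g) _ sF'; rewrite -ltnS -cF ltnS => /(_ Fm) {}IH.
have {}IH : #|containing (F :\ g)| * #|T| ^ #|F :\ g| <= (2 * k) ^ #|F :\ g| * #|k_regular_graphs|.
  by apply: IH; lia.
have := containing_switch gF sF; rewrite cF -mulnn in le *.
have [k0|k0] := posnP k; first by move: le; rewrite k0 !muln0.
set X := #|containing F|; set Y := #|containing _|.
set f := #|F :\ g| in le IH *; set n := #|T| in le IH *; set p := #|k_regular_graphs|.
move=> h; have h' : X * n <= 2 * k * Y.
  rewrite -(leq_pmul2r k0); apply: leq_trans (_ : 2 * (X * (n * k - 2 * k.+1 * k - 2 * f.+1)) <= _).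
    by rewrite -mulnA [leqRHS]mulnCA leq_mul2l; apply/orP; right; lia.
  apply: leq_trans (leq_mul (leqnn 2) h) _; lia.
rewrite !expnS mulnA; apply: leq_trans (leq_mul h' (leqnn _)) _.
by rewrite -!mulnA !leq_mul2l IH !orbT.
Qed.

(** * Dense small sets *)

Definition with_dense_set (s q : nat) := [set E in k_regular_graphs |
  [exists S : {set T}, (#|S| == s) && (q <= #|[set e in E | e \subset S]|)]].

(** Union bound over the set $S$ and over $q$ of the vertex pairs inside it, with [card_containing]
    for each choice. *)
Lemma card_with_dense_set s q : 4 * q + 4 * k.+1 * k <= #|T| * k ->
  #|with_dense_set s q| * #|T| ^ q <=
  'C(#|T|, s) * 'C('C(s, 2), q) * (2 * k) ^ q * #|k_regular_graphs|.
Proof.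
move=> hq; have [->|n0] := posnP (#|T| ^ q); first by rewrite muln0.
pose cand (S : {set T}) := [set F : {set {set T}} |
  (F \subset [set e : {set T} | e \subset S & #|e| == 2]) & #|F| == q].
pose Z := \bigcup_(S : {set T} | #|S| == s) \bigcup_(F in cand S) containing F.
have sub : with_dense_set s q \subset Z.
  apply/subsetP => E; rewrite inE => /andP[gE /existsP[S /andP[cS dS]]].
  have [F FS cF] := exists_subset_card dS.
  apply/bigcupP; exists S => //; apply/bigcupP; exists F.
    rewrite inE cF eqxx andbT; apply/subsetP => e /(subsetP FS); rewrite !inE => /andP[eE ->].
    by move: gE; rewrite inE => /andP[/forall_inP sE _]; apply: sE.
  by rewrite inE gE; apply/subsetP => e /(subsetP FS); rewrite inE => /andP[].
set p := (2 * k) ^ q * #|k_regular_graphs| %/ #|T| ^ q.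
have cont (S : {set T}) F : F \in cand S -> #|containing F| <= p.
  rewrite inE => /andP[FS /eqP cF].
  have sF : simple_graph F.
    by apply/forall_inP => e /(subsetP FS); rewrite inE => /andP[].
  by rewrite /p leq_divRL // -cF; apply: card_containing => //; rewrite cF.
have le : #|with_dense_set s q| <= 'C(#|T|, s) * ('C('C(s, 2), q) * p).
  apply: leq_trans (subset_leq_card sub) _.
  have -> : 'C(#|T|, s) = #|[pred S : {set T} | #|S| == s]|.
    by rewrite -card_draws cardsE.
  apply: leq_card_bigcup => S /eqP cS.
  have -> : 'C('C(s, 2), q) = #|[pred F in cand S]|.
    by rewrite -cS -cards_draws -cards_draws; apply: eq_card => F; rewrite !inE.
  exact: leq_card_bigcup (cont S).
apply: leq_trans (leq_mul le (leqnn _)) _.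
by rewrite -!mulnA leq_mul2l leq_mul2l leq_trunc_div !orbT.
Qed.

(** * Sparse cuts between large sets *)

Section Cut.
Variables A B : {set T}.
Hypothesis AB : [disjoint A & B].

Definition cut_pairs E : {set T * T} :=
  [set q | [&& q.1 \in A, q.2 \in B & adjacent_vertices E q.1 q.2]].

Definition with_cut (j : nat) := [set E in k_regular_graphs | #|cut_pairs E| == j].

Lemma in_with_cut E j :
  (E \in with_cut j) = (E \in k_regular_graphs) && (#|cut_pairs E| == j).
Proof. by rewrite inE. Qed.

Lemma card_off_cut_pairs E (X Y : {set T}) : E \in k_regular_graphs ->
  #|[set q : T * T | [&& q.1 \in X, q.2 \notin Y & adjacent_vertices E q.1 q.2]]| +
  #|[set q : T * T | [&& q.1 \in X, q.2 \in Y & adjacent_vertices E q.1 q.2]]| = #|X| * k.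
Proof.
move=> gE; rewrite -(card_adjacent_pairs X gE) addnC.
rewrite -[RHS](cardsID [set q : T * T | q.2 \in Y]).
by congr addn; apply: eq_card => q; rewrite !inE; case: (q.1 \in X); case: (q.2 \in Y);
  rewrite ?andbT ?andbF.
Qed.

(* The switching creates the edge ac between A and B; the other new edge be may
   be a second one. *)
Lemma with_cut_switch j :
  #|with_cut j| * ((#|A| * k - j) * (#|B| * k - j - 2 * k.+1 * k)) <=
  #|with_cut j.+1 :|: with_cut j.+2| * (j.+2 * (#|T| * k)).
Proof.
(* With [b] outside $B$ and [e] outside $A$, the removed edges are not in the cut, so no cut edge is
   lost. *)
pose W := [set q : {set {set T}} * ((T * T) * (T * T)) |
  [&& q.2.1.1 \in A, q.2.1.2 \notin B, q.2.2.1 \in B, q.2.2.2 \notin A &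
   switchable q.1 q.2.1.1 q.2.1.2 q.2.2.1 q.2.2.2]].
pose W' := [set q : {set {set T}} * ((T * T) * (T * T)) |
  ((q.2.1.1, q.2.2.1) \in cut_pairs q.1) && adjacent_vertices q.1 q.2.1.2 q.2.2.2].
apply: (@double_counting _ _ ((T * T) * (T * T))%type _ _ W W'
          (fun E q => switch E q.1.1 q.1.2 q.2.1 q.2.2)).
- move=> E [[a b] [c e]]; rewrite inE => /andP[gE /eqP cE].
  rewrite inE /= => /and5P[aA bB cB eA sw].
  have aB := disjointFr AB aA; have cA := disjointFl AB cB.
  have swr := switch_regular gE sw.
  case/and5P: sw => ab ce ac be _.
  have sub1 : (a, c) |: cut_pairs E \subset cut_pairs (switch E a b c e).
    apply/subsetP => -[x y]; rewrite !inE /= => /orP[/eqP[-> ->]|].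
      by rewrite aA cB /adjacent_vertices !inE eqxx orbT.
    case/and3P => xA yB xy; rewrite xA yB /= /adjacent_vertices !inE.
    rewrite -/(adjacent_vertices E x y) xy andbT !eq_set2.
    apply/orP; left; rewrite !negb_or !negb_and.
    have -> : y != b by apply: contraNneq bB => <-.
    have -> : y != a by apply: contraTneq yB => ->; rewrite aB.
    have -> : x != c by apply: contraTneq xA => ->; rewrite cA.
    have -> : x != e by apply: contraNneq eA => <-.
    by rewrite !orbT.
  have sub2 : cut_pairs (switch E a b c e) \subset (b, e) |: ((a, c) |: cut_pairs E).
    apply/subsetP => -[x y]; rewrite !inE /= => /and3P[xA yB].
    rewrite /adjacent_vertices !inE xA yB /= => /orP[/andP[_ ->]|]; first by rewrite !orbT.
    rewrite !eq_set2 => /orP[|] /orP[] /andP[/eqP xE /eqP yE]; subst x y.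
    + by rewrite eqxx orbT.
    + by move: xA; rewrite cA.
    + by rewrite eqxx.
    + by move: eA; rewrite xA.
  split; last by rewrite inE /= !inE /= aA cB /adjacent_vertices !inE !eqxx !orbT.
  have l1 := subset_leq_card sub1; have l2 := subset_leq_card sub2.
  have acE : (a, c) \notin cut_pairs E by rewrite !inE /= aA cB.
  rewrite cardsU1 acE cE in l1.
  have l3 : #|(b, e) |: ((a, c) |: cut_pairs E)| <= j.+2.
    by rewrite !cardsU1 acE cE; case: (_ \notin _).
  have := leq_trans l2 l3.
  by rewrite in_setU !in_with_cut swr /=; move: l1; rewrite add1n; move: #|cut_pairs _| => x;
    clear; lia.
- move=> E E' [[a b] [c e]] _ _; rewrite !inE /= => /and5P[_ _ _ _ sw] /and5P[_ _ _ _ sw'] h.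
  by rewrite -(switchK sw) -(switchK sw') h.
- move=> E; rewrite inE => /andP[gE /eqP cE].
  pose P := [set q : T * T | [&& q.1 \in A, q.2 \notin B & adjacent_vertices E q.1 q.2]].
  pose Q := [set q : T * T | [&& q.1 \in B, q.2 \notin A & adjacent_vertices E q.1 q.2]].
  have cP : #|A| * k - j <= #|P|.
    by rewrite leq_subLR addnC -(card_off_cut_pairs A B gE) -cE.
  have cQ : #|B| * k - j <= #|Q|.
    rewrite leq_subLR addnC -(card_off_cut_pairs B A gE) leq_add2l -cE.
    have inj : injective (fun q : T * T => (q.2, q.1)) by case=> ? ? [? ?] [-> ->].
    rewrite -(card_imset _ inj); apply: subset_leq_card; apply/subsetP => q.
    case/imsetP => -[x y]; rewrite !inE /= => /and3P[h1 h2 h3] -> /=.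
    by rewrite h1 h2 adjacentC.
  apply: leq_trans (leq_mul cP (leqnn _)) _; apply: card_pair_geq => -[a b].
  rewrite inE /= => /and3P[aA bB ab].
  have hQ q : q \in Q -> adjacent_vertices E q.1 q.2 by rewrite inE => /and3P[].
  apply: leq_trans (leq_trans (leq_sub2r _ cQ) (card_far_pairs a b gE hQ)) _.
  apply: subset_leq_card; apply/subsetP => -[c e]; rewrite !inE /switchable /=.
  by rewrite aA bB ab => /andP[/and3P[-> -> ->] /and4P[-> -> -> ->]].
(* For a reversal, $(a,c)$ is one of at most $j+2$ cut pairs and $(b,e)$ one of the $nk$ ordered
   adjacent pairs. *)
- move=> E EE; have [gE cE] : E \in k_regular_graphs /\ #|cut_pairs E| <= j.+2.
    by move: EE; rewrite in_setU !in_with_cut => /orP[] /andP[-> /eqP ->].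
  apply: leq_trans (leq_mul cE (leqnn _)); rewrite -(card_all_adjacent_pairs gE) -cardsX.
  have inj : injective (fun q : (T * T) * (T * T) => ((q.1.1, q.2.1), (q.1.2, q.2.2))).
    by case=> [[? ?] [? ?]] [[? ?] [? ?]] /= [-> -> -> ->].
  rewrite -(card_imset _ inj); apply: subset_leq_card; apply/subsetP => q.
  case/imsetP => -[[a b] [c e]]; rewrite 2!inE /= => /andP[h1 h2] -> /=.
  by rewrite inE h1 inE.
Qed.

(** For $j \le 2M$ there are at least $\frac38 (sg\,k)^2$ forward switchings and at most $(j+2)nk$
    backward ones; the hypothesis on $M$ makes the ratio at least $4$. Each switching adds at most
    two cut edges, so this can be iterated $M$ times from $j = 0$. *)
Lemma card_with_cut0 sg M : #|A| = sg -> #|B| = sg -> 16 * k.+1 <= sg ->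
  0 < k -> 32 * M.+1 * #|T| <= k * sg ^ 2 ->
  #|with_cut 0| * 2 ^ M <= #|k_regular_graphs|.
Proof.
move=> cA cB sk k0 hM.
have sgT : sg <= #|T| by rewrite -cA max_card.
have sg0 : 0 < sg by apply: leq_trans sk.
have step j : j <= 2 * M -> 4 * #|with_cut j| <= #|with_cut j.+1 :|: with_cut j.+2|.
  move=> jM; have := with_cut_switch j; rewrite cA cB.
  set x := #|with_cut j|; set y := #|_ :|: _|; set n := #|T| in sgT hM * => h.
  have j4 : 4 * j <= sg * k.
    rewrite -(@leq_pmul2r (4 * n)) ?muln_gt0 ?(leq_trans sg0 sgT) //.
    apply: leq_trans (_ : 32 * M.+1 * n <= _); last first.
      by apply: leq_trans hM _; rewrite -mulnn; nia.
    by nia.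
  have h1 : 3 * (sg * k) <= 4 * (sg * k - j) by lia.
  have h2 : 2 * (sg * k) <= 4 * (sg * k - j - 2 * k.+1 * k).
    have : 16 * k.+1 * k <= sg * k by rewrite leq_mul2r sk orbT.
    lia.
  have h3 : 6 * (sg * k) ^ 2 * x <= 16 * (y * (j.+2 * (n * k))).
    apply: leq_trans (leq_mul (leqnn 16) h).
    have -> : 16 * (x * ((sg * k - j) * (sg * k - j - 2 * k.+1 * k))) =
      (4 * (sg * k - j)) * (4 * (sg * k - j - 2 * k.+1 * k)) * x by lia.
    rewrite leq_mul2r; apply/orP; right; apply: leq_trans (leq_mul h1 h2).
    by rewrite -mulnn; lia.
  have h4 : 16 * j.+2 * n <= k * sg ^ 2 by apply: leq_trans hM; rewrite leq_mul2r; lia.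
  have p0 : 0 < k * (k * sg ^ 2) by rewrite !muln_gt0 k0 sg0.
  rewrite -(leq_pmul2r p0).
  apply: leq_trans (_ : 6 * (sg * k) ^ 2 * x <= _).
    by rewrite expnMn -!mulnn; nia.
  apply: leq_trans h3 _.
  have -> : 16 * (y * (j.+2 * (n * k))) = y * (k * (16 * j.+2 * n)) by lia.
  by rewrite !leq_mul2l h4 !orbT.
(* If levels $j+1$ and $j+2$ each hold at most a $2^{-m}$ share of the graphs, their union holds at
   most $2 \cdot 2^{-m}$, and level $j$ at most a quarter of that. *)
have main : forall m j, j + 2 * m <= 2 * M.+1 -> #|with_cut j| * 2 ^ m <= #|k_regular_graphs|.
  elim=> [|m IH] j jm.
    by rewrite muln1 subset_leq_card //; apply/subsetP => E; rewrite in_with_cut => /andP[].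
  have l1 := IH j.+1; have l2 := IH j.+2.
  have := step j; have := leq_card_setU (with_cut j.+1) (with_cut j.+2).
  have {}l1 : #|with_cut j.+1| * 2 ^ m <= #|k_regular_graphs| by apply: l1; lia.
  have {}l2 : #|with_cut j.+2| * 2 ^ m <= #|k_regular_graphs| by apply: l2; lia.
  move: l1 l2; set x := #|with_cut j|; set y := #|with_cut j.+1|; set z := #|with_cut j.+2|.
  set w := #|_ :|: _|; set p := #|k_regular_graphs|; rewrite expnS; set e := 2 ^ m.
  move=> l1 l2 l3 l4; have {}l4 : 4 * x <= w by apply: l4; lia.
  have : 4 * x * e <= (y + z) * e by rewrite leq_mul2r (leq_trans l4 l3) orbT.
  lia.
by apply: main; lia.
Qed.

End Cut.

(** * Rigid partitions from balanced colourings *)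

Lemma sum_degrees_inside E (X : {set T}) : simple_graph E ->
  \sum_(x in X) #|[set y in X | adjacent_vertices E x y]| = 2 * #|[set e in E | e \subset X]|.
Proof.
move=> sE; have sE' : simple_graph [set e in E | e \subset X].
  by apply/forall_inP => e; rewrite inE => /andP[/(forall_inP sE)].
rewrite -(handshake sE') card_pair big_mkcond /=; apply: eq_bigr => x _.
case: ifP => xX; last first.
  apply/esym/eq_card0 => y; rewrite !inE /= /adjacent_vertices inE subUset sub1set xX.
  by rewrite andbF.
by apply: eq_card => y; rewrite !inE /adjacent_vertices inE subUset !sub1set xX andbC.
Qed.

Section Deterministic.
Variables (E : {set {set T}}) (sg t d : nat) (f : {ffun T -> 'I_d}).
Hypothesis E_regular : E \in k_regular_graphs.
Hypothesis t_gt0 : 0 < t.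
Hypothesis T_gt0 : 0 < #|T|.
Hypothesis sg_small : sg * k <= t * #|T|.
Hypothesis E_sparse : forall s, 0 < s <= 2 * sg -> E \notin with_dense_set s (t * s).
Hypothesis E_cut : forall A B : {set T}, [disjoint A & B] -> #|A| = sg -> #|B| = sg ->
  E \notin with_cut A B 0.
Hypothesis f_balanced : forall v i,
  2 * t <= #|[set w in [set w | adjacent_vertices E v w] | f w == i]|.

Let V i := [set v | f v == i].

(** Every vertex sends at least $2t$ edges into [V i], which can receive only $k$ per vertex; hence
    $k|V_i| \ge 2t|T| \ge 2\,sg\,k$. *)
Lemma class_large i : 0 < k -> 2 * sg <= #|V i|.
Proof.
move=> k0; rewrite -(leq_pmul2r k0) -(card_adjacent_pairs (V i) E_regular).
apply: leq_trans (_ : #|[set: T]| * (2 * t) <= _); first by rewrite cardsT; lia.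
have inj : injective (fun q : T * T => (q.2, q.1)) by case=> ? ? [? ?] [-> ->].
rewrite -(card_imset _ inj); apply: card_pair_geq => v _.
apply: leq_trans (f_balanced v i) _; apply: subset_leq_card; apply/subsetP => w.
rewrite !inE => /andP[vw wi]; apply/imsetP; exists (w, v) => //.
by rewrite !inE /= wi adjacentC.
Qed.

(** By the handshake identity inside $X$, it spans at least $t|X|$ edges, which [E_sparse] forbids
    for small sets. *)
Lemma closed_set_large (X : {set T}) : X != set0 ->
  (forall x, x \in X -> 2 * t <= #|[set y in X | adjacent_vertices E x y]|) ->
  2 * sg < #|X|.
Proof.
move=> X0 hX; rewrite ltnNge; apply/negP => Xs.
have sE : simple_graph E by move: E_regular; rewrite inE => /andP[].
have := E_sparse (s := #|X|); rewrite card_gt0 X0 Xs => /(_ isT) /negP; apply.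
rewrite inE E_regular /=; apply/existsP; exists X; rewrite eqxx /=.
rewrite -(@leq_pmul2l 2) // -(sum_degrees_inside X sE).
by rewrite mulnA mulnC -sum_nat_const; apply: leq_sum.
Qed.

Lemma large_cut (X Y : {set T}) : [disjoint X & Y] -> sg <= #|X| -> sg <= #|Y| ->
  exists2 x, x \in X & exists2 y, y \in Y & adjacent_vertices E x y.
Proof.
move=> XY /exists_subset_card[X' X'X cX] /exists_subset_card[Y' Y'Y cY].
have XY' : [disjoint X' & Y'] by apply: disjointWl X'X _; apply: disjointWr XY.
have := E_cut XY' cX cY; rewrite in_with_cut E_regular /= cards_eq0.
case/set0Pn => -[x y]; rewrite inE => /and3P[/= h1 h2 h3].
by exists x; [exact: (subsetP X'X)|exists y => //; exact: (subsetP Y'Y)].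
Qed.

Lemma classes_connected i j : 0 < k -> connected_between E (V i) (V j).
Proof.
move=> k0; apply/forall_inP => x xV; apply/forall_inP => y yV; apply/negPn/negP => nxy.
set r := adjacent_between E (V i) (V j) in nxy.
have rsym : symmetric r.
  move=> a b; rewrite /r /adjacent_between adjacentC; congr andb.
  by rewrite orbC ![(b \in _) && _]andbC.
have csym := sym_connect_sym rsym.
(* A vertex of [V i] uses its neighbours of colour [j] and conversely, so these neighbours stay in
   the same component. *)
have target z : z \in V i :|: V j -> exists c : 'I_d, forall w, adjacent_vertices E z w ->
    f w == c -> w \in V i :|: V j /\ r z w.
  rewrite inE => /orP[] zV; [exists j|exists i] => w zw wc;
    by rewrite /r /adjacent_between zw zV !inE wc ?orbT.
pose X := [set z in V i :|: V j | connect r x z].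
pose Y := [set z in V i :|: V j | ~~ connect r x z].
have XY : [disjoint X & Y].
  rewrite -setI_eq0; apply/eqP/setP => z; rewrite !inE.
  by case: (connect r x z); rewrite ?andbF.
have X_large : 2 * sg < #|X|.
  apply: closed_set_large => [|z]; first by apply/set0Pn; exists x; rewrite inE xV connect0.
  rewrite inE => /andP[zV xz]; have [c hc] := target z zV.
  apply: leq_trans (f_balanced z c) _; apply: subset_leq_card; apply/subsetP => w.
  rewrite 2!inE => /andP[zw wc]; have [wV zw'] := hc w zw wc.
  by rewrite 2!inE wV zw andbT; apply: connect_trans xz (connect1 zw').
have Y_large : 2 * sg < #|Y|.
  apply: closed_set_large => [|z]; first by apply/set0Pn; exists y; rewrite inE yV nxy.
  rewrite inE => /andP[zV xz]; have [c hc] := target z zV.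
  apply: leq_trans (f_balanced z c) _; apply: subset_leq_card; apply/subsetP => w.
  rewrite 2!inE => /andP[zw wc]; have [wV zw'] := hc w zw wc.
  rewrite 2!inE wV zw andbT; apply: contraNN xz => xw; apply: connect_trans xw _.
  by rewrite csym connect1.
have cut i' j' : (forall a b, a \in V i' -> b \in V j' -> adjacent_vertices E a b -> r a b) ->
    #|X :&: V i'| < sg \/ #|Y :&: V j'| < sg.
  move=> rij; have [?|lX] := ltnP #|X :&: V i'| sg; first by left.
  have [?|lY] := ltnP #|Y :&: V j'| sg; first by right.
  have XY' : [disjoint X :&: V i' & Y :&: V j'].
    by apply: disjointWl (subsetIl _ _) _; apply: disjointWr (subsetIl _ _) XY.
  have [a /setIP[aX aV] [b /setIP[bY bV] ab]] := large_cut XY' lX lY.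
  move: aX bY; rewrite !(inE, in_setU) => /andP[_ xa] /andP[_ /negP[]].
  exact: connect_trans xa (connect1 (rij a b aV bV ab)).
have cut1 : #|X :&: V i| < sg \/ #|Y :&: V j| < sg.
  by apply: cut => a b aV bV ab; rewrite /r /adjacent_between ab aV bV.
have cut2 : #|X :&: V j| < sg \/ #|Y :&: V i| < sg.
  by apply: cut => a b aV bV ab; rewrite /r /adjacent_between ab aV bV orbT.
have splitW (Z : {set T}) : Z \subset V i :|: V j -> #|Z| <= #|Z :&: V i| + #|Z :&: V j|.
  by move=> /setIidPl {1}<-; rewrite setIUr leq_card_setU.
have splitV l : V l \subset V i :|: V j -> #|V l| <= #|X :&: V l| + #|Y :&: V l|.
  move=> Vl; apply: leq_trans (leq_card_setU _ _); apply: subset_leq_card.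
  apply/subsetP => z zl; rewrite !inE in zl *; move/subsetP/(_ z): Vl.
  by rewrite !inE zl => /(_ isT) ->; rewrite !andTb !andbT orbN.
have XW : X \subset V i :|: V j by apply/subsetP => z; rewrite inE => /andP[].
have YW : Y \subset V i :|: V j by apply/subsetP => z; rewrite inE => /andP[].
(* Each of the four combinations of [cut1] and [cut2] forces one of [X], [Y], [V i], [V j] below
   $2\,sg$ vertices, a contradiction. *)
have := splitW X XW; have := splitW Y YW.
have := splitV i (subsetUl _ _); have := splitV j (subsetUr _ _).
have := class_large i k0; have := class_large j k0.
move: X_large Y_large cut1 cut2.
move: #|V i| #|V j| #|X| #|Y| #|X :&: V i| #|X :&: V j| #|Y :&: V i| #|Y :&: V j|.
clear; lia.
Qed.

Lemma rigid_of_balanced_colouring : has_strong_rigid_partition d E.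
Proof.
have /card_gt0P[v0 _] := T_gt0.
have [k0|k0] := posnP k.
  have i := f v0; have := f_balanced v0 i; rewrite leqNgt => /negP[].
  apply: leq_ltn_trans (_ : k < _); last by rewrite k0 muln_gt0.
  rewrite -(card_adjacent E_regular v0); apply: subset_leq_card.
  by apply/subsetP => w; rewrite inE => /andP[].
have Vne i : V i != set0.
  have : 0 < #|[set w in [set w | adjacent_vertices E v0 w] | f w == i]|.
    by apply: leq_trans (f_balanced v0 i); rewrite muln_gt0.
  by case/card_gt0P => w; rewrite !inE => /andP[_ wi]; apply/set0Pn; exists w; rewrite inE.
have Vinj : injective V.
  move=> i j Vij; have /set0Pn[v vi] := Vne i; have vj := vi; rewrite Vij in vj.
  by rewrite !inE in vi vj; rewrite -(eqP vi) (eqP vj).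
apply/existsP; exists [set V i | i : 'I_d]; apply/and3P; split.
- apply/and3P; split.
  + apply/eqP/setP => v; rewrite inE; apply/bigcupP; exists (V (f v)); rewrite ?inE //.
    exact: imset_f.
  + apply/trivIsetP => _ _ /imsetP[i _ ->] /imsetP[j _ ->] ij.
    rewrite -setI_eq0; apply/eqP/setP => v; rewrite !inE.
    by apply/negbTE; apply: contraNN ij => /andP[/eqP-> /eqP->].
  + by apply/imsetP => -[i _ e]; move: (Vne i); rewrite -e eqxx.
- by rewrite card_imset // card_ord.
- by apply/forall_inP => _ /imsetP[i _ ->]; apply/forall_inP => _ /imsetP[j _ ->];
  apply: classes_connected.
Qed.

End Deterministic.

End Switch.

(** * Existence of regular graphs *)

Section Circulant.
Import GRing.Theory.
Local Open Scope ring_scope.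
Variables (m : nat) (D : {set 'I_m.+1}).
Hypothesis D0 : 0 \notin D.
Hypothesis DN : forall x, (- x \in D) = (x \in D).

(** Cayley graph of $\mathbb Z/(m+1)$ with connection set [D]; [D0] excludes loops and [DN] makes
    adjacency symmetric. *)
Definition circulant : {set {set 'I_m.+1}} :=
  [set e | [exists x, exists y, (e == [set x; y]) && (y - x \in D)]].

Lemma circulant_adjacent x y : adjacent_vertices circulant x y = (y - x \in D).
Proof.
rewrite /adjacent_vertices inE; apply/existsP/idP => [[x' /existsP[y' /andP[]]]|xy].
  rewrite eq_set2 => /orP[] /andP[/eqP-> /eqP->] //.
  by rewrite -DN opprB.
by exists x; apply/existsP; exists y; rewrite eqxx.
Qed.

Lemma circulant_regular : circulant \in k_regular_graphs 'I_m.+1 #|D|.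
Proof.
rewrite inE; apply/andP; split.
  apply/forall_inP => e; rewrite inE => /existsP[x /existsP[y /andP[/eqP -> xy]]].
  by have [xE|xy'] := eqVneq x y; [move: xy; rewrite xE subrr (negbTE D0)|rewrite cards2 xy'].
apply/forallP => x; apply/eqP; rewrite -[RHS](card_imset _ (addrI x)).
apply: eq_card => y; rewrite inE circulant_adjacent; apply/idP/imsetP => [xy|[z zD ->]].
  by exists (y - x) => //; rewrite addrC subrK.
by rewrite addrAC subrr add0r.
Qed.
End Circulant.

Section RegularGraphExists.
Import GRing.Theory.
Local Open Scope ring_scope.

Lemma double_eq0_card m : (#|[set x : 'I_m.+1 | (x + x == 0)%R]| <= 2)%N.
Proof.
have c2 : (#|[set (0%R : 'I_m.+1); inord (half m.+1)]| <= 2)%N by rewrite cards2; case: (_ != _).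
apply: leq_trans c2; apply: subset_leq_card; apply/subsetP => x;
  rewrite !inE -!val_eqE /= => /eqP e.
have xm := ltn_ord x.
have [x0|x0] := posnP x; first by apply/orP; left; apply/eqP.
apply/orP; right.
have xx : (x + x = m.+1)%N.
  have /dvdnP[q qE] : (m.+1 %| x + x)%N by rewrite /dvdn e.
  have : (0 < q)%N by case: q qE => //; lia.
  have : (q < 2)%N by rewrite -(@ltn_pmul2r m.+1) // -qE; lia.
  by case: q qE => [|[|q]] // ->; lia.
have h : nat_of_ord x = half m.+1 by rewrite -[in RHS]xx addnn doubleK.
have hm : (half m.+1 < m.+1)%N by rewrite -h.
by apply/eqP; rewrite (inordK hm).
Qed.

(** Pairs $\{x,-x\}$ with $2x \ne 0$ are added one by one. At most two elements satisfy $2x = 0$, so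
    the size bound always leaves a free $x$. *)
Lemma symmetric_set_even m h : (h.*2 + 2 <= m.+1)%N ->
  exists D : {set 'I_m.+1}, [/\ forall x, (- x \in D) = (x \in D),
    forall x, x \in D -> x + x != 0 & #|D| = h.*2].
Proof.
elim: h => [_|h IH hm].
  by exists set0; split=> [x|x|]; rewrite ?inE // cards0.
have [|D [DN D2 cD]] := IH; first by lia.
pose Z := [set x : 'I_m.+1 | x + x == 0]; have cZ : (#|Z| <= 2)%N := double_eq0_card m.
have : (0 < #|~: (D :|: Z)|)%N.
  have := cardsC (D :|: Z); rewrite card_ord; have := leq_of_leqif (leq_card_setU D Z); rewrite cD.
  by move: cZ hm; move: #|D :|: Z| #|~: (D :|: Z)| #|Z| => a b c; clear; lia.
case/card_gt0P => x; rewrite !inE negb_or => /andP[xD x2].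
have xN : x != - x by rewrite -subr_eq0 opprK.
exists (x |: (- x |: D)); split.
- by move=> y; rewrite !inE DN eqr_oppLR eqr_opp orbCA.
- move=> y; rewrite !inE => /or3P[/eqP->|/eqP->|/D2] //.
  by rewrite -opprD oppr_eq0.
- by rewrite !cardsU1 !inE DN (negbTE xD) (negbTE xN) cD; lia.
Qed.

(** This keeps the uniform distribution from being taken on an empty set. For even $k$ a symmetric
    set of size $k$ serves; for odd $k$, $n$ is even and $n/2$, its own negative, is added to a set
    of size $k-1$. *)
Lemma k_regular_graphs_gt0 n k : ~~ odd (n * k) -> (k.+2 <= n)%N ->
  (0 < #|k_regular_graphs 'I_n k|)%N.
Proof.
case: n => // m ev km; have [|D [DN D2 cD]] := @symmetric_set_even m (half k).
  have := odd_double_half k; lia.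
have D0 : 0 \notin D by apply/negP => /D2; rewrite addr0 eqxx.
have [ko|ke] := boolP (odd k); last first.
  apply/card_gt0P; exists (circulant D); have := circulant_regular D0 DN.
  by rewrite cD even_halfK.
have me : ~~ odd m.+1 by move: ev; rewrite oddM ko andbT.
pose x : 'I_m.+1 := inord (half m.+1).
have xE : (x + x = m.+1 :> nat)%N.
  rewrite /x inordK; last by move: km; lia.
  by rewrite addnn even_halfK.
have x2 : x + x = 0 by apply/val_inj; rewrite /= xE modnn.
have xD : x \notin D by apply/negP => /D2; rewrite x2 eqxx.
have x0 : x != 0 by apply/eqP => x0; move: xE; rewrite x0 /=; lia.
apply/card_gt0P; exists (circulant (x |: D)).
have -> : k = #|x |: D| by rewrite cardsU1 xD cD; have := odd_double_half k; rewrite ko.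
apply: circulant_regular; first by rewrite !inE negb_or eq_sym x0.
move=> y; rewrite !inE DN eqr_oppLR; congr ((_ == _) || _).
by apply/esym/eqP; rewrite -addr_eq0 x2.
Qed.
End RegularGraphExists.

(** * Union bounds *)

Section Asymptotics.
Variables (T : finType) (a d k t u : nat).
Hypothesis d_gt0 : 0 < d.
Hypothesis a_large : 256 <= a.
Hypothesis t_le : 16 * d * t <= k.
Hypothesis t_ge : k < 16 * d * t.+1.
Hypothesis u_gt0 : 0 < u.
Hypothesis u_large : (64 * a * d) ^ 2 <= 2 ^ u.
Hypothesis t_large : 16 * a * u <= t.
Hypothesis T_large : 64 * a * d * k.+1 <= #|T|.

Let n := #|T|.
(** Here [t] is the floor of $k/(16d)$, and [u] is a decay rate: a fixed pair of sets of size [sg]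
    has no edge in between with probability at most $2^{1-u\,sg}$, which has to beat the at most
    $(32ad)^{2sg}$ pairs. *)
Let sg := n %/ (4 * a * d).
Let G := #|k_regular_graphs T k|.

Let ad_gt0 : 0 < a * d. Proof. by rewrite muln_gt0 d_gt0 (leq_trans _ a_large). Qed.
Let ad4_gt0 : 0 < 4 * a * d. Proof. by rewrite -mulnA muln_gt0 ad_gt0. Qed.

Let u_le_t : u <= t.
Proof.
apply: leq_trans t_large; rewrite leq_pmull // muln_gt0 /=.
exact: leq_trans a_large.
Qed.

Let t_gt0 : 0 < t. Proof. exact: leq_trans u_gt0 u_le_t. Qed.

Let k_le : k <= 32 * d * t.
Proof.
apply: leq_trans (ltnW t_ge) _.
have : d * 1 <= d * t by rewrite leq_mul2l t_gt0 orbT.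
rewrite mulnS -!mulnA; lia.
Qed.

Let k_gt0 : 0 < k. Proof. by apply: leq_trans t_le; rewrite !muln_gt0 d_gt0 t_gt0. Qed.

Let sg_le : 4 * a * d * sg <= n. Proof. by rewrite mulnC leq_trunc_div. Qed.

Let sg_ge : 16 * k.+1 <= sg.
Proof.
rewrite leq_divRL ?ad4_gt0 //; apply: leq_trans T_large; rewrite leq_eqVlt; apply/orP; left.
by apply/eqP; lia.
Qed.

Let sg_gt0 : 0 < sg. Proof. by apply: leq_trans sg_ge. Qed.

Let n_le : n <= 8 * a * d * sg.
Proof.
have := ltn_ceil n ad4_gt0; rewrite -/sg => /ltnW h; apply: leq_trans h _.
have : 4 * a * d * 1 <= 4 * a * d * sg by rewrite leq_mul2l sg_gt0 orbT.
rewrite mulSn muln1; lia.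
Qed.

Let n_gt0 : 0 < n.
Proof. by apply: leq_trans sg_le; rewrite muln_gt0 ad4_gt0 sg_gt0. Qed.

Let pow_t_large : (64 * a * d) ^ 2 <= 2 ^ t.
Proof. by apply: leq_trans u_large _; rewrite leq_exp2l // u_le_t. Qed.

(** Size $s$ contributes a share of at most $(s/n)^s$, and these shares sum to at most $4/n$. *)
Lemma dense_total :
  n * #|\bigcup_(s < (2 * sg).+1 | 0 < s) with_dense_set T k s (t * s)| <= 4 * G.
Proof.
pose b s := #|with_dense_set T k s (t * s)|.
apply: leq_trans (_ : n * \sum_(1 <= s < (2 * sg).+1) b s <= _).
  rewrite leq_mul2l; apply/orP; right.
  have -> : \sum_(1 <= s < (2 * sg).+1) b s = \sum_(s < (2 * sg).+1 | 0 < s) b s.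
    rewrite -(big_mkord (fun s => 0 < s) b) [RHS]big_ltn_cond //=.
    by rewrite [LHS]big_nat_cond [RHS]big_nat_cond; apply: eq_bigl => s; lia.
  elim/big_rec2: _ => [|s x Y _ le]; first by rewrite cards0.
  by apply: leq_trans (leq_card_setU _ _) _; rewrite leq_add2l.
apply: geometric_sum_bound n_gt0 _ => s /andP[s0 s2].
have hs : 2 * (a * d * s) <= n.
  apply: leq_trans sg_le.
  have : a * d * s <= a * d * (2 * sg) by rewrite leq_mul2l s2 orbT.
  lia.
split.
  by apply: leq_trans hs; rewrite leq_mul2l /= leq_pmull ?ad_gt0.
apply: (dense_set_term (a := a) s0 t_gt0 _ hs).
- apply: leq_trans (leq_mul (leqnn 8) k_le) _.
  have -> : 8 * (32 * d * t) = 256 * (d * t) by lia.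
  by rewrite -mulnA leq_mul2r a_large orbT.
- by apply: leq_trans pow_t_large; apply: leq_expl; rewrite -!mulnA leq_mul2r; lia.
apply: card_with_dense_set.
have l1 : 8 * k.+1 * k <= n * k.
  rewrite leq_mul2r; apply/orP; right; apply: leq_trans sg_le.
  by apply: leq_trans (leq_pmull _ ad4_gt0); apply: leq_trans sg_ge; rewrite leq_mul2r orbT.
have l2 : 8 * (t * s) <= n * k.
  apply: leq_trans (leq_mul hs t_le).
  have -> : 2 * (a * d * s) * (16 * d * t) = (a * d * d * 32) * (t * s) by lia.
  rewrite leq_mul2r; apply/orP; right; apply: (@leq_trans 32) => //.
  by rewrite leq_pmull // muln_gt0 ad_gt0 d_gt0.
by move: l1 l2; rewrite -/n; lia.
Qed.

Definition sparse_cut_graphs :=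
  \bigcup_(q : {set T} * {set T} | [&& #|q.1| == sg, #|q.2| == sg & [disjoint q.1 & q.2]])
    with_cut k q.1 q.2 0.

Lemma sparse_cut_total : n * #|sparse_cut_graphs| <= 16 * a * d * G.
Proof.
(* [card_with_cut0] constrains [M.+1], which becomes $u\,sg$. *)
pose M := (u * sg).-1.
have MS : M.+1 = u * sg by rewrite prednK // muln_gt0 u_gt0 sg_gt0.
have M0 : 0 < 2 ^ M by rewrite expn_gt0.
have hM : 32 * M.+1 * n <= k * sg ^ 2.
  rewrite MS; apply: leq_trans (leq_mul (leqnn _) n_le) _.
  apply: leq_trans (_ : 16 * d * t * sg ^ 2 <= _); last by rewrite leq_mul2r t_le orbT.
  have -> : 32 * (u * sg) * (8 * a * d * sg) = 16 * d * sg ^ 2 * (16 * a * u) by rewrite -mulnn;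
    lia.
  have -> : 16 * d * t * sg ^ 2 = 16 * d * sg ^ 2 * t by lia.
  by rewrite leq_mul2l t_large orbT.
have le : #|sparse_cut_graphs| <= 'C(n, sg) ^ 2 * (G %/ 2 ^ M).
  apply: leq_trans (leq_card_bigcup (r := G %/ 2 ^ M) _) _.
    move=> [A B] /and3P[/= /eqP cA /eqP cB AB]; rewrite leq_divRL //.
    exact: card_with_cut0 AB _ _ cA cB sg_ge k_gt0 hM.
  rewrite leq_mul2r; apply/orP; right.
  rewrite -mulnn -(card_draws T sg) -cardsX; apply: subset_leq_card; apply/subsetP => q.
  by rewrite !inE unfold_in => /and3P[-> ->].
have le' : #|sparse_cut_graphs| * 2 ^ M <= 'C(n, sg) ^ 2 * G.
  apply: leq_trans (leq_mul le (leqnn _)) _.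
  by rewrite -mulnA leq_mul2l leq_trunc_div orbT.
set y := 32 * a * d.
have y0 : 0 < y by rewrite /y -mulnA muln_gt0 ad_gt0.
have leC : 'C(n, sg) <= y ^ sg.
  have p0 : 0 < sg ^ sg by rewrite expn_gt0 sg_gt0.
  rewrite -(leq_pmul2r p0); apply: leq_trans (bin_mul_self _ _) _.
  rewrite -expnMn; apply: leq_expl.
  have -> : y * sg = 4 * (8 * a * d * sg) by rewrite /y; move: sg => x; clear; lia.
  by rewrite leq_mul2l n_le orbT.
(* This is $4(32ad)^2 = (64ad)^2 \le 2^u$ raised to the power [sg]. The spare $4^{sg}$ later absorbs
   $n \le 8ad\,sg$. *)
have big : 4 ^ sg * (y ^ sg) ^ 2 <= 2 * 2 ^ M.
  rewrite -expnS MS expnM -expnM [sg * 2]mulnC expnM -expnMn; apply: leq_expl.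
  apply: leq_trans u_large; rewrite /y -!mulnn; lia.
have key : #|sparse_cut_graphs| * 4 ^ sg <= 2 * G.
  have p0 : 0 < (y ^ sg) ^ 2 by rewrite !expn_gt0 y0.
  rewrite -(leq_pmul2r p0) -mulnA; apply: leq_trans (leq_mul (leqnn _) big) _.
  rewrite mulnCA -mulnA leq_mul2l /=; apply: leq_trans le' _.
  by rewrite mulnC leq_mul2l leq_expl ?orbT.
have sg4 : sg <= 4 ^ sg by apply: ltnW; apply: ltn_expl.
apply: leq_trans (leq_mul n_le (leqnn _)) _.
have -> : 16 * a * d * G = 8 * a * d * (2 * G) by lia.
rewrite -mulnA leq_mul2l; apply/orP; right; apply: leq_trans key.
by rewrite mulnC leq_mul2l sg4 orbT.
Qed.

Lemma rigid_of_typical E : E \in k_regular_graphs T k ->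
  E \notin \bigcup_(s < (2 * sg).+1 | 0 < s) with_dense_set T k s (t * s) ->
  E \notin sparse_cut_graphs -> has_strong_rigid_partition d E.
Proof.
move=> gE dense cut.
(* Follows from $k \le 32dt$, $t \le 2^t$ and $(64d)^2 \le 2^t$. *)
have kd : 4 * k ^ 2 * d <= 2 ^ (6 * t).
  have p1 : 64 * d * 1 <= 64 * a * d by rewrite muln1 -!mulnA leq_mul2l leq_pmull ?orbT //
    (leq_trans _ a_large).
  have p2 : (64 * d) ^ 2 <= 2 ^ t by apply: leq_trans pow_t_large; apply: leq_expl;
    rewrite muln1 in p1.
  have tt : t ^ 2 <= 2 ^ t * 2 ^ t by rewrite -mulnn leq_mul // ltnW // ltn_expl.
  have -> : 2 ^ (6 * t) = (2 ^ t * 2 ^ t) * (2 ^ t) * (2 ^ t) * (2 ^ t * 2 ^ t) by rewrite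
    -!expnD; congr (2 ^ _); lia.
  apply: leq_trans (_ : (t ^ 2) * (64 * d) ^ 2 * (64 * d) ^ 2 * 1 <= _); last first.
    apply: leq_mul; last by rewrite muln_gt0 !expn_gt0.
    by apply: leq_mul => //; apply: leq_mul.
  apply: leq_trans (_ : 4 * (32 * d * t) ^ 2 * d <= _).
    by rewrite leq_mul2r leq_mul2l leq_expl ?orbT // k_le.
  have -> : 4 * (32 * d * t) ^ 2 * d = t ^ 2 * (64 * d) ^ 2 * d by rewrite -!mulnn; lia.
  rewrite muln1 leq_mul2l -mulnn; apply/orP; right.
  by have : d * 1 <= d * d by [rewrite leq_mul2l d_gt0 orbT]; lia.
have [|f hf] := @balanced_colouring T (fun v => [set w | adjacent_vertices E v w]) d k t d_gt0
  t_le kd (card_adjacent gE).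
  move=> w; rewrite -[leqRHS](card_adjacent gE w) subset_leq_card //.
  by apply/subsetP => v; rewrite !inE adjacentC.
apply: (@rigid_of_balanced_colouring T k E sg t d f gE t_gt0 n_gt0) => //.
- apply: leq_trans (leq_mul (leqnn _) k_le) _.
  apply: leq_trans (_ : t * (4 * a * d * sg) <= _); last by rewrite leq_mul2l sg_le orbT.
  have -> : sg * (32 * d * t) = 8 * 4 * (t * d * sg) by lia.
  have -> : t * (4 * a * d * sg) = a * 4 * (t * d * sg) by lia.
  by rewrite !leq_mul2r (leq_trans _ a_large) ?orbT.
- move=> s /andP[s0 s2]; apply: contraNN dense => h; apply/bigcupP.
  by exists (Ordinal (s2 : s < (2 * sg).+1)).
- move=> A B AB cA cB; apply: contraNN cut => h; apply/bigcupP.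
  by exists (A, B) => //=; rewrite cA cB eqxx AB.
Qed.

Lemma few_not_rigid :
  n * #|[set E in k_regular_graphs T k | ~~ has_strong_rigid_partition d E]|
    <= (4 + 16 * a * d) * G.
Proof.
rewrite mulnDl; apply: leq_trans (leq_add dense_total sparse_cut_total).
rewrite -mulnDr leq_mul2l; apply/orP; right; apply: leq_trans (leq_card_setU _ _).
apply: subset_leq_card; apply/subsetP => E; rewrite inE => /andP[gE]; apply: contraNT.
by rewrite in_setU negb_or => /andP[h1 h2]; apply: rigid_of_typical.
Qed.

End Asymptotics.

(** The integer [l] stands for $\log_2 d$ rounded up. The constant [K] is uniform in $d$ and $k$,
    while [c] and [n0] may depend on them. *)
Lemma exists_threshold : exists2 K, 0 < K & forall d k l,
  0 < d -> 0 < l -> d <= 2 ^ l -> K * d * l <= k ->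
  exists c n0, forall n, n0 <= n ->
    n * #|[set E in regular_graphs n k | ~~ has_strong_rigid_partition d E]|
      <= c * #|regular_graphs n k|.
Proof.
have [a a_large] : exists a, 256 <= a by exists 256.
pose b := 64 * a; have b_large : 64 * a <= 2 ^ b by apply: ltnW; apply: ltn_expl.
have a0 : 0 < a by apply: leq_trans a_large.
(* With $u = 2(b+l)$ and $t = \lfloor k/(16d) \rfloor$, the condition $16au \le t$ amounts to $k \ge
   512ad(b+l)$, and $b+l \le (b+1)l$. *)
exists (512 * a * b.+1) => [|d k l d0 l0 dl hk]; first by rewrite !muln_gt0 a0.
pose t := k %/ (16 * d); pose u := 2 * (b + l).
have d16 : 0 < 16 * d by rewrite muln_gt0.
exists (4 + 16 * a * d), (64 * a * d * k.+1) => n hn.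
rewrite -{1}(card_ord n); apply: (@few_not_rigid 'I_n a d k t u) => //.
- by rewrite mulnC leq_trunc_div.
- by rewrite mulnC ltn_ceil.
- by rewrite muln_gt0 addn_gt0 l0 orbT.
- have -> : 2 ^ u = (2 ^ b * 2 ^ l) ^ 2 by rewrite /u mulnC expnM expnD.
  by rewrite leq_expl // leq_mul.
- rewrite /t leq_divRL //; apply: leq_trans hk.
  have bl : b + l <= b.+1 * l by rewrite mulSn addnC leq_add2l leq_pmulr.
  have -> : 16 * a * u * (16 * d) = 512 * (a * d * (b + l)) by rewrite /u; lia.
  have -> : 512 * a * b.+1 * d * l = 512 * (a * d * (b.+1 * l)) by lia.
  by rewrite !leq_mul2l bl !orbT.
- by rewrite card_ord.
Qed.

(** * Probabilities, natural logarithms and the limit *)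

Import GRing.Theory Num.Theory.

Lemma prob_uniform_on_compl (R : numFieldType) (X : finType) (S : {set X}) (Q : pred X) :
  0 < #|S| ->
  (1 - prob_uniform_on R S Q = #|[set x in S | ~~ Q x]|%:R / #|S|%:R)%R.
Proof.
move=> S0; have S0' : (#|S|%:R != 0 :> R)%R by rewrite pnatr_eq0 -lt0n.
apply: (mulIf S0'); rewrite /prob_uniform_on mulrBl mul1r !divfK //.
have -> : #|S| = #|[set x in S | Q x]| + #|[set x in S | ~~ Q x]|.
  rewrite -(cardsID [set x | Q x]).
  by congr addn; apply: eq_card => x; rewrite !inE // andbC.
by rewrite natrD addrC addKr.
Qed.

From mathcomp Require Import all_classical all_reals all_analysis.

Import Order.TTheory GRing.Theory Num.Theory.
Import numFieldNormedType.Exports.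

Local Open Scope classical_set_scope.
Local Open Scope ring_scope.

(** The inequality $\ln(1+x) \le x$ at $x = -1/2$. *)
Lemma ln2_ge (R : realType) : 2^-1 <= ln (2 : R).
Proof.
have h : -1 < - 2^-1 :> R by rewrite ltrN2 invf_lt1 // ltr1n.
have := le_ln1Dx h; have -> : 1 + - 2^-1 = 2^-1 :> R.
  by rewrite {1}(splitr 1) mul1r addrK.
by rewrite lnV ?posrE // lerN2.
Qed.

(** Write the rounded logarithm as $m+1$ with $2^m \le d$. Then $m \le 2\ln d$ because $\ln 2 \ge
    1/2$, and the rounding error $1$ is at most $2\ln 2 \le 2\ln d$. *)
Lemma up_log_le_ln (R : realType) d : (2 <= d)%N -> (up_log 2 d)%:R <= 4 * ln (d%:R : R).
Proof.
move=> d2; have d0 : (0 < d)%N by apply: leq_trans d2.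
have l2 := ln2_ge R.
have ld : ln 2 <= ln (d%:R : R) by rewrite ler_ln ?posrE ?ltr0n // ler_nat.
have l0 : (0 < up_log 2 d)%N by rewrite up_log_gt0.
have : (2 ^ (up_log 2 d).-1 <= d)%N by rewrite ltnW // up_log_gtn.
rewrite -(ler_nat R) -ler_ln ?posrE ?ltr0n ?expn_gt0 // natrX lnXn ?posrE //.
rewrite -{2}(prednK l0); move: (up_log 2 d).-1 => m.
rewrite -[_ *+ m]mulr_natr -[m.+1%:R]natr1; have := ler_wpM2r (ler0n R m) l2; lra.
Qed.

Theorem theorem1p8 (R : realType) :
  exists C : R, 0 < C /\
    forall d k : nat, (2 <= d)%N -> C * d%:R * ln (d%:R : R) <= k%:R ->
      prob_uniform_on R (regular_graphs n k)
        (fun E : {set {set 'I_n}} => has_strong_rigid_partition d E)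
      @[n --> within [set n : nat | ~~ odd (n * k)%N] \oo] --> (1 : R).
Proof.
have [K K0 HK] := exists_threshold.
(* The factor 4 pays for replacing [up_log 2 d] by $\ln d$. *)
exists (4 * K%:R); split; first by rewrite mulr_gt0 ?ltr0n.
move=> d k d2 hk; have d0 : (0 < d)%N by apply: leq_trans d2.
have [|||c [n0 hc]] := HK d k (up_log 2 d) d0.
- by rewrite up_log_gt0.
- exact: up_logP.
- rewrite -(ler_nat R); apply: le_trans hk; rewrite !natrM.
  rewrite [X in _ <= X](_ : _ = K%:R * d%:R * (4 * ln d%:R)); last by ring.
  by rewrite ler_wpM2l ?mulr_ge0 // up_log_le_ln.
apply/cvgrPdist_le => e e0; rewrite near_withinE.
have [N hN] : exists N : nat, c%:R / e <= N%:R.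
  by exists (Num.truncn (c%:R / e)).+1; rewrite ltW // truncnS_gt.
(* [n0] serves the counting bound, [k.+2] the existence of a $k$-regular graph, and [N.+1] gives $n
   > 0$ and $c/n \le e$. *)
exists (maxn (maxn n0 k.+2) N.+1) => // n /=; rewrite !geq_max => /andP[/andP[hn0 hk2] nN] ev.
have G0 := k_regular_graphs_gt0 ev hk2; rewrite -/(regular_graphs n k) in G0.
have := hc n hn0; rewrite prob_uniform_on_compl //.
set bad := #|_|; set S := #|_| => hbad.
have S0 : 0 < S%:R :> R by rewrite ltr0n.
rewrite ger0_norm ?divr_ge0 // ler_pdivrMr //.
have n_gt0 : 0 < n%:R :> R by rewrite ltr0n (leq_trans _ nN).
rewrite -(ler_pM2l n_gt0); apply: le_trans (_ : c%:R * S%:R <= _).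
  by rewrite -!natrM ler_nat.
rewrite mulrA ler_wpM2r //; move: hN; rewrite ler_pdivrMr // => /le_trans; apply.
by rewrite ler_wpM2r ?(ltW e0) // ler_nat ltnW.
Qed.
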